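(* Suppose that $u \in H^1(B_1)$ is not identically $0$ and is a non-negative minimiser of $E$ in $B_1$, i.e. $E(u) \leq E(v)$ for all $v \in H^1(B_1)$ such that $u - v \in H^1_0(B_1)$. Then $u$ is strictly positive in the interior of $B_1$.
   Context: $B_1$ is the unit ball of $\mathbb{R}^n$ centred at the origin. For a measurable set $\Omega$, $Per(\Omega, B_1) = \sup\{\int_{\Omega \cap B_1} \mathrm{div}\,\xi : \xi \in C^1_0(B_1;\mathbb{R}^n), \|\xi\|_{L^\infty} \leq 1\}$, where $C^1_0$ denotes $C^1$ functions with compact support. The Dirichlet-area energy is $E(v) = \int_{B_1} |\nabla v|^2 + Per(\{v>0\}, B_1)$. Elements of $H^1(B_1)$ are, as usual, identified when they agree almost everywhere. *)

(* Defs.v *)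
From HB Require Import structures.
From mathcomp Require Import all_boot all_order all_algebra.
From mathcomp Require Import all_classical all_reals all_analysis.

Set Implicit Arguments.
Unset Strict Implicit.
Unset Printing Implicit Defensive.

Import Order.TTheory GRing.Theory Num.Theory.
Import numFieldNormedType.Exports.

Local Open Scope classical_set_scope.
Local Open Scope ring_scope.

Definition measure_row_display : measure_display -> measure_display.
Proof. exact. Qed.

Definition row_coord {R : realType} {n : nat} (i : 'I_n) (x : 'rV[R]_n) : R :=
  x ord0 i.

Section measurable_row.
Context {R : realType} {n : nat}.

(* The product sigma-algebra, as the library does for [n.-tuple R]; on [R^n]
   it is the Borel sigma-algebra. *)
Let row_measurable : set (set 'rV[R]_n) := g_sigma_preimage row_coord.

Let row_measurable0 : row_measurable set0.
Proof. exact: sigma_algebra0. Qed.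

Let row_measurableC A : row_measurable A -> row_measurable (~` A).
Proof. exact: sigma_algebraC. Qed.

Let row_measurable_bigcup (F : _^nat) :
  (forall i, row_measurable (F i)) -> row_measurable (\bigcup_i (F i)).
Proof. exact: sigma_algebra_bigcup. Qed.

HB.instance Definition _ :=
  @isMeasurable.Build (measure_row_display default_measure_display)
    'rV[R]_n row_measurable row_measurable0 row_measurableC
    row_measurable_bigcup.

End measurable_row.

Section measurable_row_theory.
Context {R : realType}.

Lemma measurable_row_coord n (i : 'I_n) :
  measurable_fun [set: 'rV[R]_n] (row_coord i).
Proof.
move=> _ Y mY; rewrite setTI; apply: sub_sigma_algebra => /=.
rewrite -bigcup_seq/=; exists i => /=; first by rewrite mem_index_enum.
by exists Y => //; rewrite setTI.
Qed.

Lemma measurable_fun_rowP d (T : measurableType d) n (f : T -> 'rV[R]_n) :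
  measurable_fun [set: T] f <->
  forall i, measurable_fun [set: T] (row_coord i \o f).
Proof.
split=> [mf i|mf].
  exact: measurableT_comp (measurable_row_coord i) mf.
move=> _ A mA; rewrite setTI.
suff : measurable `<=` [set B | measurable (f @^-1` B)] by exact.
apply: smallest_sub.
  split => /=.
  - by rewrite preimage_set0; exact: measurable0.
  - by move=> B mB; rewrite setTD preimage_setC; exact: measurableC.
  - by move=> F mF; rewrite preimage_bigcup; exact: bigcup_measurable.
rewrite -bigcup_seq; apply: bigcup_sub => i _ _ [B mB <-] /=.
by rewrite setTI; have := mf i measurableT B mB; rewrite setTI.
Qed.

Definition row_cons n (p : measurableTypeR R * 'rV[R]_n) : 'rV[R]_n.+1 :=
  \row_(i < n.+1) oapp (p.2 ord0) p.1 (unlift ord0 i).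

Lemma row_cons0 n (p : measurableTypeR R * 'rV[R]_n) : row_cons p ord0 ord0 = p.1.
Proof. by rewrite mxE unlift_none. Qed.

Lemma row_consS n (p : measurableTypeR R * 'rV[R]_n) (i : 'I_n) :
  row_cons p ord0 (lift ord0 i) = p.2 ord0 i.
Proof. by rewrite mxE liftK. Qed.

Definition row_uncons n (x : 'rV[R]_n.+1) : measurableTypeR R * 'rV[R]_n :=
  (x ord0 ord0, \row_(i < n) x ord0 (lift ord0 i)).

Lemma row_consK n : cancel (@row_cons n) (@row_uncons n).
Proof.
move=> [a v]; rewrite /row_uncons row_cons0; congr pair.
by apply/rowP => i; rewrite mxE row_consS.
Qed.

Lemma row_unconsK n : cancel (@row_uncons n) (@row_cons n).
Proof.
move=> x; apply/rowP => i; case: (unliftP ord0 i) => [j|] ->.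
  by rewrite row_consS mxE.
by rewrite row_cons0.
Qed.

Lemma measurable_row_cons n :
  measurable_fun [set: measurableTypeR R * 'rV[R]_n] (@row_cons n).
Proof.
apply/measurable_fun_rowP => i.
case: (unliftP ord0 i) => [j|] ->.
  rewrite (_ : _ \o _ = row_coord j \o snd); last first.
    by apply/funext => p /=; rewrite /row_coord row_consS.
  exact: measurableT_comp (measurable_row_coord j) measurable_snd.
rewrite (_ : _ \o _ = fst); first exact: measurable_fst.
by apply/funext => p /=; rewrite /row_coord row_cons0.
Qed.

Lemma measurable_row_uncons n :
  measurable_fun [set: 'rV[R]_n.+1] (@row_uncons n).
Proof.
apply/measurable_fun_pairP; split; first exact: measurable_row_coord ord0.
apply/measurable_fun_rowP => i.
rewrite (_ : _ \o _ = row_coord (lift ord0 i)).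
  exact: measurable_row_coord.
by apply/funext => x /=; rewrite /row_coord mxE.
Qed.

End measurable_row_theory.

Section prepend_lebesgue.
Local Open Scope ereal_scope.
Context {R : realType} {n : nat}.
Variable m : {sigma_finite_measure set 'rV[R]_n -> \bar R}.

Let mu : {measure set (measurableTypeR R * 'rV[R]_n)%type -> \bar R} :=
  lebesgue_measure \x m.

Definition prepend_lebesgue : set 'rV[R]_n.+1 -> \bar R :=
  pushforward (lebesgue_measure \x m) (@row_cons R n).

Let measurable_preimage A : measurable A -> measurable (@row_cons R n @^-1` A).
Proof.
by move=> mA; rewrite -[X in measurable X]setTI; exact: measurable_row_cons.
Qed.

Let prepend_lebesgue0 : prepend_lebesgue set0 = 0.
Proof. exact: (measure0 mu). Qed.

Let prepend_lebesgue_ge0 A : 0 <= prepend_lebesgue A.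
Proof. exact: (measure_ge0 mu). Qed.

Let prepend_lebesgue_sigma_additive : semi_sigma_additive prepend_lebesgue.
Proof.
move=> F mF tF mUF; rewrite /prepend_lebesgue /pushforward preimage_bigcup.
apply: (measure_semi_sigma_additive (s := mu)).
- by move=> k; exact: measurable_preimage.
- apply/trivIsetP => /= i j _ _ ij; rewrite -preimage_setI.
  by move/trivIsetP : tF => /(_ _ _ _ _ ij) ->//; rewrite preimage_set0.
- by rewrite -preimage_bigcup; exact: measurable_preimage.
Qed.

HB.instance Definition _ := isMeasure.Build _ _ _ prepend_lebesgue
  prepend_lebesgue0 prepend_lebesgue_ge0 prepend_lebesgue_sigma_additive.

Let prepend_lebesgue_sigma_finite : sigma_finite setT prepend_lebesgue.
Proof.
have /sigma_finiteP[F [TF ndF Foo]] := sigma_finiteT (@lebesgue_measure R).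
have /sigma_finiteP[G [TG ndG Goo]] := sigma_finiteT m.
exists (fun k => @row_uncons R n @^-1` (F k `*` G k)).
  rewrite -preimage_bigcup (_ : \bigcup_k _ = setT) ?preimage_setT//.
  rewrite -subTset => -[x y] _.
  have [k _ Fkx] : (\bigcup_i F i) x by rewrite -TF.
  have [l _ Gly] : (\bigcup_i G i) y by rewrite -TG.
  exists (maxn k l) => //; split => /=.
  - by move: x Fkx; exact/subsetPset/ndF/leq_maxl.
  - by move: y Gly; exact/subsetPset/ndG/leq_maxr.
move=> k; have [mF Fk] := Foo k; have [mG Gk] := Goo k.
have mFG : measurable (F k `*` G k) by exact: measurableX.
split.
  by rewrite -[X in measurable X]setTI; exact: measurable_row_uncons.
rewrite /prepend_lebesgue /pushforward -comp_preimage (_ : _ \o _ = id).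
  by rewrite preimage_id product_measure1E// lte_mul_pinfty// ge0_fin_numE.
by apply/funext => p /=; rewrite row_consK.
Qed.

HB.instance Definition _ := Measure_isSigmaFinite.Build _ _ _ prepend_lebesgue
  prepend_lebesgue_sigma_finite.

End prepend_lebesgue.

Fixpoint lebesgue_row {R : realType} (n : nat) : set 'rV[R]_n -> \bar R :=
  match n with
  | 0 => @dirac _ 'rV[R]_0 0 R
  | k.+1 =>
      pushforward (lebesgue_measure \x @lebesgue_row R k)%E (@row_cons R k)
  end.
Arguments lebesgue_row {R} n.

Section lebesgue_row_measure.
Local Open Scope ereal_scope.
Context {R : realType} {n : nat}.
Local Notation mu := (@lebesgue_row R n).

Let lebesgue_row_exists :
  exists m : {sigma_finite_measure set 'rV[R]_n -> \bar R},
    m = mu :> (set 'rV[R]_n -> \bar R).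
Proof.
elim: n => [|k [m mE]].
  by exists (@dirac _ 'rV[R]_0 0%R R).
by exists (prepend_lebesgue m); rewrite /= -mE.
Qed.

Let lebesgue_row0 : mu set0 = 0.
Proof. by have [m <-] := lebesgue_row_exists; exact: measure0. Qed.

Let lebesgue_row_ge0 A : 0 <= mu A.
Proof. by have [m <-] := lebesgue_row_exists; exact: measure_ge0. Qed.

Let lebesgue_row_sigma_additive : semi_sigma_additive mu.
Proof.
by have [m <-] := lebesgue_row_exists; exact: measure_semi_sigma_additive.
Qed.

HB.instance Definition _ := isMeasure.Build _ _ _ mu
  lebesgue_row0 lebesgue_row_ge0 lebesgue_row_sigma_additive.

Let lebesgue_row_sigma_finite : sigma_finite setT mu.
Proof. by have [m <-] := lebesgue_row_exists; exact: sigma_finiteT. Qed.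

HB.instance Definition _ := Measure_isSigmaFinite.Build _ _ _ mu
  lebesgue_row_sigma_finite.

End lebesgue_row_measure.

Lemma lebesgue_row_box {R : realType} (n : nat) (A : 'I_n -> set R) :
  (forall i, measurable (A i)) ->
  lebesgue_row n [set x : 'rV[R]_n | forall i, A i (x ord0 i)] =
  (\prod_(i < n) lebesgue_measure (A i))%E.
Proof.
elim: n A => [|n IHn] A mA.
  by rewrite big_ord0 /= diracE mem_set// => -[].
rewrite big_ord_recl -IHn; last by move=> i; exact: mA.
set B := [set x : 'rV[R]_n | _].
have mB : measurable B.
  rewrite (_ : B = \bigcap_(i in [set: 'I_n])
      (row_coord i @^-1` A (lift ord0 i))).
    apply: fin_bigcap_measurable => [|i _]; first exact: finite_finset.
    by rewrite -[X in measurable X]setTI; exact: measurable_row_coord.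
  by apply/seteqP; split => [x Bx i _|x Bx i]; [exact: Bx|exact: (Bx i I)].
transitivity ((lebesgue_measure \x lebesgue_row n)%E (A ord0 `*` B)); last first.
  exact: (product_measure1E (@lebesgue_measure R) (lebesgue_row n) (mA ord0) mB).
congr ((lebesgue_measure \x lebesgue_row n)%E _).
apply/seteqP; split => [[a v] /= Av|[a v] [/= Aa Bv] i].
  split => /=; first by have := Av ord0; rewrite row_cons0.
  by move=> i; have := Av (lift ord0 i); rewrite row_consS.
by case: (unliftP ord0 i) => [j|] ->; rewrite ?row_cons0 ?row_consS.
Qed.

Section unit_ball.
Context {R : realType} {n : nat}.
Local Notation mu := (@lebesgue_row R n).
Implicit Types (u v f g phi : 'rV[R]_n -> R) (xi : 'rV[R]_n -> 'rV[R]_n).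

(* The library's norm on ['rV[R]_n] is the maximum norm. *)
Definition enorm (x : 'rV[R]_n) : R := Num.sqrt (\sum_(i < n) x ord0 i ^+ 2).

Definition B1 : set 'rV[R]_n := [set x | enorm x < 1].

Definition partial (i : 'I_n) f (x : 'rV[R]_n) : R := 'D_(delta_mx ord0 i) f x.

Fixpoint is_Ck (k : nat) f : Prop :=
  continuous f /\
  match k with
  | 0 => True
  | l.+1 => forall i, (forall x, derivable f x (delta_mx ord0 i)) /\
                      is_Ck l (partial i f)
  end.

Definition is_Coo f : Prop := forall k, is_Ck k f.

Definition compactly_supported_in (D : set 'rV[R]_n) f : Prop :=
  compact (closure [set x | f x != 0]) /\ closure [set x | f x != 0] `<=` D.

(* Functions with compact support in the ball are extended by zero to [R^n]. *)
Definition test_function phi : Prop :=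
  is_Coo phi /\ compactly_supported_in B1 phi.

Definition test_field xi : Prop :=
  forall i : 'I_n, is_Ck 1 (row_coord i \o xi) /\
                   compactly_supported_in B1 (row_coord i \o xi).

Definition divergence xi (x : 'rV[R]_n) : R :=
  \sum_(i < n) partial i (row_coord i \o xi) x.

Definition Per (Omega : set 'rV[R]_n) : \bar R :=
  ereal_sup [set (\int[mu]_(x in Omega `&` B1) (divergence xi x)%:E)%E
            | xi in [set xi | test_field xi /\
                     (Lnorm mu +oo (fun x => (enorm (xi x))%:E) <= 1)%E]].

Definition L2 f : Prop :=
  measurable_fun B1 f /\ mu.-integrable B1 (fun x => (f x ^+ 2)%:E).

Definition is_weak_partial (i : 'I_n) u g : Prop :=
  L2 g /\ forall phi, test_function phi ->
    \int[mu]_(x in B1) (u x * partial i phi x) =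
    - \int[mu]_(x in B1) (g x * phi x).

(* Weak partial derivatives are unique only up to a null set; every use below
   is insensitive to the representative that is picked. *)
Definition weak_partial (i : 'I_n) u : 'rV[R]_n -> R :=
  xget (cst 0) [set g | is_weak_partial i u g].

Definition H1 u : Prop := L2 u /\ forall i, exists g, is_weak_partial i u g.

Definition grad_sq u (x : 'rV[R]_n) : R :=
  \sum_(i < n) weak_partial i u x ^+ 2.

Definition H1norm u : R :=
  Num.sqrt (\int[mu]_(x in B1) (u x ^+ 2) + \int[mu]_(x in B1) grad_sq u x).

Definition H10 u : Prop :=
  H1 u /\ forall e : R, 0 < e ->
    exists2 phi, test_function phi & H1norm (u \- phi) < e.

Definition energy v : \bar R :=
  (\int[mu]_(x in B1) (grad_sq v x)%:E + Per [set x | (0 < v x)%R])%E.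

Definition minimiser u : Prop :=
  H1 u /\ forall v, H1 v -> H10 (u \- v) -> (energy u <= energy v)%E.

End unit_ball.

(* Main.v *)
(** Replacing u by its harmonic replacement would remove the perimeter and lower
    the Dirichlet energy; the same gain is obtained here without constructing it.
    Let [eta] be a smooth function that is positive in the ball and vanishes on its
    boundary.  For a test function [phi >= 0] the competitor [u + t (phi + e eta)]
    is positive, so its positivity set has zero perimeter, and minimality gives
    [\int grad u . grad phi >= 0]: u is superharmonic.  Hence its averages against
    a radial kernel increase as the radius of the kernel shrinks, which bounds u
    below a.e. by a continuous function.  This bound is positive everywhere, since
    a zero of an average would propagate to the whole ball.  Now [u - t phi] is
    positive for every test function [phi] and small t, so u is harmonic, the
    averages do not depend on the radius, and u agrees a.e. with its continuous and
    positive averages. *)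
From mathcomp Require Import all_boot all_order all_algebra.
From mathcomp Require Import all_classical all_reals all_analysis.
From mathcomp Require Import measurable_realfun ring lra.
Require Import Defs.

Set Implicit Arguments.
Unset Strict Implicit.
Unset Printing Implicit Defensive.

Import Order.TTheory GRing.Theory Num.Theory.
Import numFieldNormedType.Exports.

Local Open Scope classical_set_scope.
Local Open Scope ring_scope.

(** * The flat function exp(-1/s) *)

(** The perimeter has no usable first variation, so every comparison uses a competitor that is
    positive almost everywhere in the ball: its perimeter is 0, that of [u] enters only through
    being nonnegative, and the Dirichlet integrals alone are left. At first [u] is merely
    nonnegative; this is why [eta] must be positive up to the boundary, so that it is no test
    function and its membership in [H10] takes a truncation argument. Variations of both signs have
    to wait for a lower bound of [u] on compact subsets. Since [u] is known only almost everywhere,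
    all the analysis is moved to smooth kernels. The kernel profile is the derivative of the flat
    function [exp(-1/s)], taken at a quadratic: then the derivative of the kernel in its scale is a
    multiple of the Laplacian of a nonnegative compactly supported function, and weak
    superharmonicity applies to it directly, without spherical means or surface measures. The
    passage from averages back to [u] is also weak: the average is moved onto the test function. *)

Section flat_function.
Context {R : realType}.
Implicit Types (p : {poly R}) (s y : R).

(** The polynomial parameter makes the family stable under differentiation, so that smoothness of
    all orders is a plain induction. [flat 1] is the usual [exp(-1/s)]. *)
Definition flat p s : R := if 0 < s then p.[s^-1] * expR (- s^-1) else 0.

(** The derivative of [p(1/s) exp(-1/s)] is [s^-2 (p - p')(1/s) exp(-1/s)], and [s^-2] is the value
    of ['X^2] at [1/s]. *)
Definition flat_diff p : {poly R} := 'X^2 * (p - p^`()).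

Lemma flat_le0 p s : s <= 0 -> flat p s = 0.
Proof. by rewrite /flat leNgt => /negbTE ->. Qed.

(** Term by term: the exponential series bounds each power of [y] by a factorial times [expR y]. *)
Lemma horner_expRN_bounded p :
  exists2 C : R, 0 <= C & forall y, 0 < y -> `|p.[y]| * expR (- y) <= C.
Proof.
exists (\sum_(i < size p) `|p`_i| * (i.+1)`!%:R).
  by apply: sumr_ge0 => i _; rewrite mulr_ge0.
move=> y y0; rewrite horner_coef.
apply: (@le_trans _ _ (\sum_(i < size p) (`|p`_i| * y ^+ i) * expR (- y))).
  rewrite -mulr_suml ler_wpM2r ?expR_ge0//.
  apply: le_trans (ler_norm_sum _ _ _) _; apply: ler_sum => i _.
  by rewrite normrM normrX (gtr0_norm y0).
apply: ler_sum => i _; rewrite -mulrA ler_wpM2l// expRN ler_pdivrMr ?expR_gt0//.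
case: i => -[|i] /= _.
  by rewrite expr0 mul1r -expR0 ler_expR ltW.
have := expR_ge1Dxn i (ltW y0).
have f0 : 0 < (i.+1)`!%:R :> R by rewrite ltr0n fact_gt0.
rewrite -(ler_pM2l f0) mulrDr mulr1 mulrCA divff ?gt_eqF// mulr1 => h.
apply: (@le_trans _ _ ((i.+1)`!%:R * expR y)).
  by apply: le_trans h; rewrite lerDr ltW.
by rewrite ler_wpM2r ?expR_ge0// ler_nat [leqRHS]factS leq_pmull.
Qed.

Lemma flat_bounded p : exists2 C : R, 0 <= C & forall s, `|flat p s| <= C.
Proof.
have [C C0 HC] := horner_expRN_bounded p; exists C => // s; rewrite /flat.
case: ifPn => s0; last by rewrite normr0.
by rewrite normrM (ger0_norm (expR_ge0 _)) HC// invr_gt0.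
Qed.

(** The bound for [p * 'X] absorbs the extra factor [1/s]. *)
Lemma flat_le_linear p : exists2 C : R, 0 <= C & forall s, `|flat p s| <= C * `|s|.
Proof.
have [C C0 HC] := horner_expRN_bounded (p * 'X); exists C => // s; rewrite /flat.
case: ifPn => s0; last by rewrite normr0 mulr_ge0.
rewrite normrM (ger0_norm (expR_ge0 _)) (gtr0_norm s0).
have := HC _ (eq_ind_r is_true s0 (invr_gt0 s)).
rewrite hornerMX normrM (gtr0_norm (eq_ind_r is_true s0 (invr_gt0 s))).
by rewrite mulrAC ler_pdivrMr.
Qed.

Lemma is_derive_flat p s : is_derive s 1 (flat p) (flat (flat_diff p) s).
Proof.
have [s0|s0|->] := ltgtP s 0.
- rewrite flat_le0 ?ltW//.
  have d0 : is_derive s 1 (cst 0 : R -> R) 0 by exact: is_derive_cst.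
  apply: (near_eq_is_derive _ d0); near=> t; rewrite flat_le0//; apply/ltW; near: t.
  exact: lt_nbhsl.
- have E : flat (flat_diff p) s =
    (- s ^- 2) *: (p^`()).[s^-1] * expR (- s^-1) + p.[s^-1] * (s ^- 2 * expR (- s^-1)).
    rewrite /flat s0 /flat_diff hornerM hornerXn hornerD hornerN scaleNr exprVn.
    by rewrite [_ *: _]/GRing.scale/=; ring.
  have sN0 : s != 0 by rewrite gt_eqF.
  have dV : is_derive s 1 (fun t : R => t^-1) (- s ^- 2).
    have h := is_deriveV (f := id) sN0 (is_derive_id s (1 : R)).
    by apply: is_derive_eq h _; rewrite [LHS]mulr1.
  have dp : is_derive s 1 (fun t : R => p.[t^-1]) (- s ^- 2 *: (p^`()).[s^-1]).
    have h := @is_derive1_comp _ _ _ _ _ _ (is_derive_poly p s^-1) dV.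
    by apply: is_derive_eq h _; exact: mulrC.
  have de : is_derive s 1 (fun t : R => expR (- t^-1)) (s ^- 2 * expR (- s^-1)).
    have dN : is_derive s 1 (fun t : R => - t^-1) (s ^- 2).
      by have h := is_deriveN dV; apply: is_derive_eq h _; rewrite opprK.
    have h := @is_derive1_comp _ expR (fun t => - t^-1) _ _ _ (is_derive_expR (- s^-1)) dN.
    by apply: is_derive_eq h _; exact: mulrC.
  have dM : is_derive s 1 (fun t : R => p.[t^-1] * expR (- t^-1)) (flat (flat_diff p) s).
    rewrite E; have h := @is_deriveM _ _ _ _ _ _ _ _ dp de.
    apply: is_derive_eq h _.
    rewrite [X in X + _ = _]/GRing.scale/= [X in _ + X = _]/GRing.scale/= [in LHS]addrC.
    by congr (_ + _); exact: mulrC.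
  apply: (near_eq_is_derive _ dM); near=> t.
  rewrite /flat ifT//; near: t; exact: lt_nbhsr.
- rewrite flat_le0//.
  (* The difference quotient at 0 is again flat, namely [flat (p * 'X)], and its linear bound sends
     it to 0. *)
  have [C C0 HC] := flat_le_linear (p * 'X).
  have H : (fun h : R => h^-1 *: (flat p (h *: 1 + 0) - flat p 0)) @ 0^' --> (0 : R).
    apply/cvgrPdist_le => e e0.
    near=> h.
    rewrite (flat_le0 p (lexx 0)) subr0 addr0 sub0r normrN [h *: 1]mulr1.
    rewrite [h^-1 *: _]/GRing.scale/=.
    have -> : h^-1 * flat p h = flat (p * 'X) h.
      rewrite /flat; case: ifPn => _; last by rewrite mulr0.
      by rewrite hornerMX; ring.
    apply: (le_trans (HC h)).
    apply: (@le_trans _ _ ((C + 1) * `|h|)); first by rewrite ler_wpM2r// lerDl.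
    rewrite mulrC -ler_pdivlMr ?ltr_wpDl//.
    near: h; apply: nbhs_dnbhs.
    have d0 : 0 < e / (C + 1) by rewrite divr_gt0// ltr_wpDl.
    exists (e / (C + 1)) => //= t /=; rewrite sub0r normrN => /ltW //.
  apply: DeriveDef; first by apply/cvg_ex; exists 0.
  exact: cvg_lim H.
Unshelve. all: by end_near. Qed.

Lemma continuous_flat p : continuous (flat p).
Proof.
move=> s; apply: differentiable_continuous; apply/derivable1_diffP.
by have [] := is_derive_flat p s.
Qed.

End flat_function.

(** * Partial derivatives and smooth functions *)

Section partial_calculus.
Context {R : realType} {n : nat}.
Local Notation rV := 'rV[R]_n.
Implicit Types (f g df dg : rV -> R) (i : 'I_n) (x y c : rV).

(** Existence and value of the derivative travel together, so the rules of calculus compose without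
    side conditions; [has_partialE] returns to [partial]. *)
Definition has_partial i f g := forall x, is_derive x (delta_mx ord0 i) f (g x).

Lemma has_partialE i f g : has_partial i f g -> partial i f = g.
Proof. by move=> fg; apply/funext => x; have [_ <-] := fg x. Qed.

Lemma has_partial_derivable i f g x :
  has_partial i f g -> derivable f x (delta_mx ord0 i).
Proof. by move=> /(_ x) []. Qed.

Lemma has_partial_cst i (a : R) : has_partial i (cst a) (cst 0).
Proof. by move=> x; exact: is_derive_cst. Qed.

Lemma has_partialD i f g df dg : has_partial i f df -> has_partial i g dg ->
  has_partial i (fun x => f x + g x) (fun x => df x + dg x).
Proof. by move=> hf hg x; exact: is_deriveD. Qed.

Lemma has_partialN i f df : has_partial i f df ->
  has_partial i (fun x => - f x) (fun x => - df x).
Proof. by move=> hf x; exact: is_deriveN. Qed.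

Lemma has_partialM i f g df dg : has_partial i f df -> has_partial i g dg ->
  has_partial i (fun x => f x * g x) (fun x => f x * dg x + df x * g x).
Proof.
move=> hf hg x; have h := is_deriveM (hf x) (hg x).
by apply: is_derive_eq h _; congr (_ + _); exact: mulrC.
Qed.

Lemma has_partialZ i a f df : has_partial i f df ->
  has_partial i (fun x => a * f x) (fun x => a * df x).
Proof.
move=> /(has_partialM (has_partial_cst i a)) h x.
by apply: is_derive_eq (h x) _; rewrite /= mul0r addr0.
Qed.

Lemma has_partial_sum i m (f df : 'I_m -> rV -> R) :
  (forall j, has_partial i (f j) (df j)) ->
  has_partial i (fun x => \sum_j f j x) (fun x => \sum_j df j x).
Proof.
move=> h x; have H := is_derive_sum (fun j => h j x).
rewrite (_ : (fun x => _) = \sum_j f j) //.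
by apply/funext => y; rewrite fct_sumE.
Qed.

(** Only a directional derivative of [f] is at hand, so [f] is restricted to the line through [x]
    and the one-variable chain rule is applied there. *)
Lemma has_partial_comp i (F dF : R -> R) f df :
  (forall s : R, is_derive s 1 F (dF s)) -> has_partial i f df ->
  has_partial i (fun x => F (f x)) (fun x => dF (f x) * df x).
Proof.
move=> hF hf x; set v := delta_mx _ _.
pose fl (t : R) := f (t *: v + x).
have hfl : is_derive (0 : R) 1 fl (df x).
  have [d1 d2] := hf x; apply: DeriveDef; first exact: (derivable1P f x v).1.
  rewrite -d2 /derive /fl.
  apply: (congr1 (fun g : R -> R => lim (g @ 0^'))); apply/funext => h /=.
  by rewrite addr0 scale0r add0r [_%:A]mulr1.
have hFl : is_derive (0 : R) 1 (F \o fl) (dF (f x) * df x).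
  by apply: is_derive1_comp => //; rewrite /fl scale0r add0r.
have [d1 d2] := hFl.
apply: DeriveDef; first exact: (derivable1P (fun x => F (f x)) x v).2.
rewrite -d2 /derive.
apply: (congr1 (fun g : R -> R => lim (g @ 0^'))); apply/funext => h /=.
by rewrite /fl addr0 scale0r add0r [_%:A]mulr1.
Qed.

Lemma has_partial_coord i j :
  has_partial i (fun x => x ord0 j) (cst (j == i)%:R).
Proof.
move=> x; have H : (fun h : R => h^-1 *: (((fun x => x ord0 j) \o shift x)
    (h *: delta_mx ord0 i) - x ord0 j)) @ 0^' --> ((j == i)%:R : R).
  have h : cst ((j == i)%:R : R) @ (0 : R)^' --> ((j == i)%:R : R) by exact: cvg_cst.
  apply: cvg_trans h.
  apply: near_eq_cvg; near=> h.
  rewrite /= !mxE eqxx /= addrK [RHS]mulrA mulVf ?mul1r//.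
  by near: h; exact: nbhs_dnbhs_neq.
rewrite /=; apply: DeriveDef.
  by apply/cvg_ex; exists (j == i)%:R.
exact: cvg_lim H.
Unshelve. all: by end_near. Qed.

Lemma is_derive_line i f df x (t : R) : has_partial i f df ->
  is_derive t 1 (fun t => f (x + t *: delta_mx ord0 i))
    (df (x + t *: delta_mx ord0 i)).
Proof.
move=> /(_ (x + t *: delta_mx ord0 i)) [d1 d2].
have e : (fun h : R => h^-1 *: (((fun t => f (x + t *: delta_mx ord0 i)) \o shift t) (h *: 1)
    - f (x + t *: delta_mx ord0 i))) =
   (fun h : R => h^-1 *: ((f \o shift (x + t *: delta_mx ord0 i)) (h *: delta_mx ord0 i) -
    f (x + t *: delta_mx ord0 i))).
  apply/funext => h /=; congr (_ *: (f _ - _)).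
  by rewrite [h *: 1]mulr1 scalerDl [RHS]addrCA.
apply: DeriveDef; first by rewrite /derivable e.
by rewrite /derive e.
Qed.

Lemma is_CkSP k f : is_Ck k.+1 f <-> continuous f /\
  forall i, exists2 g, has_partial i f g & is_Ck k g.
Proof.
split=> [[cf H]|[cf H]]; split => // i.
  have [d ck] := H i; by exists (partial i f).
have [g hg kg] := H i; split; first by move=> x; exact: has_partial_derivable hg.
by rewrite (has_partialE hg).
Qed.

Lemma is_Ck_continuous k f : is_Ck k f -> continuous f.
Proof. by case: k => [|k] []. Qed.

Lemma is_CkW k f : is_Ck k.+1 f -> is_Ck k f.
Proof.
elim: k f => [|k IH] f; first by case.
move=> /is_CkSP[cf H]; apply/is_CkSP; split => // i.
by have [g hg /IH kg] := H i; exists g.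
Qed.

Lemma is_Ck_cst k (a : R) : is_Ck k (cst a : rV -> R).
Proof.
elim: k a => [|k IH] a; first by split => // x; exact: cst_continuous.
apply/is_CkSP; split => [x|i]; first exact: cst_continuous.
by exists (cst 0) => //; exact: has_partial_cst.
Qed.

Lemma is_CkD k f g : is_Ck k f -> is_Ck k g -> is_Ck k (fun x => f x + g x).
Proof.
elim: k f g => [|k IH] f g.
  by move=> [cf _] [cg _]; split => // x; apply: continuousD; [exact: cf|exact: cg].
move=> /is_CkSP[cf Hf] /is_CkSP[cg Hg]; apply/is_CkSP; split => [x|i].
  by apply: continuousD; [exact: cf|exact: cg].
have [df hf kf] := Hf i; have [dg hg kg] := Hg i.
by exists (fun x => df x + dg x); [exact: has_partialD|exact: IH].
Qed.

Lemma is_CkM k f g : is_Ck k f -> is_Ck k g -> is_Ck k (fun x => f x * g x).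
Proof.
elim: k f g => [|k IH] f g.
  by move=> [cf _] [cg _]; split => // x; apply: continuousM; [exact: cf|exact: cg].
move=> Cf Cg; move: (Cf) (Cg) => /is_CkSP[cf Hf] /is_CkSP[cg Hg].
apply/is_CkSP; split => [x|i].
  by apply: continuousM; [exact: cf|exact: cg].
have [df hf kf] := Hf i; have [dg hg kg] := Hg i.
exists (fun x => f x * dg x + df x * g x); first exact: has_partialM.
by apply: is_CkD; apply: IH => //; exact: is_CkW.
Qed.

Lemma is_CkZ k (a : R) f : is_Ck k f -> is_Ck k (fun x => a * f x).
Proof. exact/is_CkM/is_Ck_cst. Qed.

Lemma is_CkN k f : is_Ck k f -> is_Ck k (fun x => - f x).
Proof.
move=> /(is_CkZ (-1)); rewrite (_ : (fun x => _) = (fun x => - f x))//.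
by apply/funext => x; rewrite mulN1r.
Qed.

Lemma is_Ck_sum k m (f : 'I_m -> rV -> R) : (forall j, is_Ck k (f j)) ->
  is_Ck k (fun x => \sum_j f j x).
Proof.
elim: m f => [|m IH] f Hf.
  by under eq_fun do rewrite big_ord0; exact: is_Ck_cst.
by under eq_fun do rewrite big_ord_recl; apply: is_CkD => //; exact: IH.
Qed.

Lemma is_Ck_prod k m (f : 'I_m -> rV -> R) : (forall j, is_Ck k (f j)) ->
  is_Ck k (fun x => \prod_j f j x).
Proof.
elim: m f => [|m IH] f Hf.
  by under eq_fun do rewrite big_ord0; exact: is_Ck_cst.
by under eq_fun do rewrite big_ord_recl; apply: is_CkM => //; exact: IH.
Qed.

Lemma is_Ck_coord k j : is_Ck k (fun x => x ord0 j).
Proof.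
case: k => [|k]; first by split => //; exact: coord_continuous.
apply/is_CkSP; split => [|i]; first exact: coord_continuous.
by exists (cst (j == i)%:R); [exact: has_partial_coord|exact: is_Ck_cst].
Qed.

(** The induction is over all [p] at once: a derivative replaces [p] by [flat_diff p] and brings out
    a factor with one order of smoothness less. *)
Lemma is_Ck_flat k p f : is_Ck k f -> is_Ck k (fun x => flat p (f x)).
Proof.
elim: k p f => [|k IH] p f.
  move=> [cf _]; split => // x.
  by apply: continuous_comp; [exact: cf|exact: continuous_flat].
move=> Cf; move: (Cf) => /is_CkSP[cf Hf].
apply/is_CkSP; split => [x|i].
  by apply: continuous_comp; [exact: cf|exact: continuous_flat].
have [df hf kf] := Hf i; exists (fun x => flat (flat_diff p) (f x) * df x).
  by apply: has_partial_comp => // s; exact: is_derive_flat.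
by apply: is_CkM => //; apply: IH; exact: is_CkW.
Qed.

(** The square keeps it polynomial, hence smooth at the centre too; balls are described through it
    everywhere below. *)
Definition sqdist c x : R := \sum_i (x ord0 i - c ord0 i) ^+ 2.

Lemma has_partial_sqdist i c :
  has_partial i (sqdist c) (fun x => 2 * (x ord0 i - c ord0 i)).
Proof.
have H := @has_partial_sum i n (fun j x => (x ord0 j - c ord0 j) ^+ 2)
  (fun j x => 2 * (x ord0 j - c ord0 j) * (j == i)%:R).
have {}H : has_partial i (sqdist c)
    (fun x => \sum_j 2 * (x ord0 j - c ord0 j) * (j == i)%:R).
  apply: H => j x.
  have h1 := has_partialD (has_partial_coord i j) (has_partial_cst i (- c ord0 j)).
  have h2 := has_partialM h1 h1 x.
  rewrite [X in is_derive _ _ X _](_ : _ =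
      (fun x : rV => (x ord0 j - c ord0 j) * (x ord0 j - c ord0 j))).
    by apply: is_derive_eq h2 _ => /=; ring.
  by apply/funext => y; rewrite expr2.
move=> x; apply: is_derive_eq (H x) _.
by rewrite (bigD1 i)//= eqxx mulr1 big1 ?addr0// => j /negbTE ->; rewrite mulr0.
Qed.

Lemma is_Ck_sqdist k c : is_Ck k (sqdist c).
Proof.
apply: is_Ck_sum => j.
have h := is_CkD (is_Ck_coord k j) (is_Ck_cst k (- c ord0 j)).
by under eq_fun do rewrite expr2; exact: is_CkM.
Qed.

Lemma sqdist_ge0 c x : 0 <= sqdist c x.
Proof. by apply: sumr_ge0 => i _; exact: sqr_ge0. Qed.

Lemma sqdistC c x : sqdist c x = sqdist x c.
Proof. by apply: eq_bigr => i _; rewrite -sqrrN opprB. Qed.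

End partial_calculus.
Notation "'sqn' x" := (sqdist 0 x) (at level 10).

(** * Integrable functions *)

Section real_integral.
Context d (T : measurableType d) (R : realType).
Variable mu : {measure set T -> \bar R}.
Implicit Types (f g h : T -> R) (C a : R).
Local Notation L1 f := (mu.-integrable setT (EFin \o f)).

Lemma L1_measurable f : L1 f -> measurable_fun setT f.
Proof. by move=> /measurable_int /measurable_EFinP. Qed.

Lemma L1_dom f g : measurable_fun setT f -> L1 g ->
  (forall x, `|f x| <= `|g x|) -> L1 f.
Proof.
move=> mf ig fg; apply: le_integrable ig => //; first exact/measurable_EFinP.
by move=> x _ /=; rewrite lee_fin.
Qed.

Lemma L1_norm f : L1 f -> L1 (fun x => `|f x|).
Proof. exact: integrable_norm. Qed.

Lemma L1D f g : L1 f -> L1 g -> L1 (fun x => f x + g x).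
Proof. exact: integrableD. Qed.

Lemma L1B f g : L1 f -> L1 g -> L1 (fun x => f x - g x).
Proof. exact: integrableB. Qed.

Lemma L1Z a f : L1 f -> L1 (fun x => a * f x).
Proof. exact: integrableZl. Qed.

Lemma L1_sum m (f : 'I_m -> T -> R) : (forall i, L1 (f i)) ->
  L1 (fun x => \sum_i f i x).
Proof.
elim: m f => [|m IH] f Hf.
  by under eq_fun do rewrite big_ord0; exact: integrable0.
by under eq_fun do rewrite big_ord_recl; apply: L1D => //; exact: IH.
Qed.

Lemma L1M_bounded f g C : L1 f -> measurable_fun setT g ->
  (forall x, `|g x| <= C) -> L1 (fun x => f x * g x).
Proof.
move=> f1 mg gC; apply: (@L1_dom _ (fun x => C * f x)).
- by apply: measurable_funM => //; exact: L1_measurable.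
- exact: L1Z.
- move=> x; rewrite !normrM mulrC ler_wpM2r//.
  by apply: le_trans (gC x) _; exact: ler_norm.
Qed.

Lemma intD f g : L1 f -> L1 g ->
  \int[mu]_x (f x + g x) = \int[mu]_x f x + \int[mu]_x g x.
Proof. exact: RintegralD. Qed.

Lemma intB f g : L1 f -> L1 g ->
  \int[mu]_x (f x - g x) = \int[mu]_x f x - \int[mu]_x g x.
Proof. exact: RintegralB. Qed.

Lemma intZ a f : L1 f -> \int[mu]_x (a * f x) = a * \int[mu]_x f x.
Proof. exact: RintegralZl. Qed.

Lemma int_sum m (f : 'I_m -> T -> R) : (forall i, L1 (f i)) ->
  \int[mu]_x (\sum_i f i x) = \sum_i \int[mu]_x f i x.
Proof.
elim: m f => [|m IH] f Hf.
  rewrite big_ord0; under eq_fun do rewrite big_ord0.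
  by rewrite Rintegral_cst// mul0r.
rewrite big_ord_recl -IH//; under eq_fun do rewrite big_ord_recl.
by apply: intD => //; exact: L1_sum.
Qed.

Lemma int_le f g : L1 f -> L1 g -> (forall x, f x <= g x) ->
  \int[mu]_x f x <= \int[mu]_x g x.
Proof. by move=> f1 g1 fg; apply: le_Rintegral. Qed.

Lemma int_ge0 f : (forall x, 0 <= f x) -> 0 <= \int[mu]_x f x.
Proof. by move=> f0; apply: Rintegral_ge0. Qed.

Lemma int_norm_le f g : L1 f -> L1 g -> (forall x, `|f x| <= g x) ->
  `|\int[mu]_x f x| <= \int[mu]_x g x.
Proof.
move=> f1 g1 fg; apply: le_trans (le_normr_Rintegral _ f1) _ => //.
by apply: int_le => //; exact: L1_norm.
Qed.

Lemma int_fin f : L1 f -> (\int[mu]_x (f x)%:E = (\int[mu]_x f x)%R%:E)%E.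
Proof. by move=> f1; rewrite fineK//; exact: integrable_fin_num. Qed.

Lemma int_ae f g : measurable_fun setT f -> measurable_fun setT g ->
  {ae mu, forall x, f x = g x} -> \int[mu]_x f x = \int[mu]_x g x.
Proof.
move=> mf mg fg; congr fine; apply: ae_eq_integral => //.
- exact/measurable_EFinP.
- exact/measurable_EFinP.
- by apply: filterS fg => x -> _.
Qed.

Lemma int_norm_eq0 f : L1 f -> \int[mu]_x `|f x| = 0 ->
  {ae mu, forall x, f x = 0}.
Proof.
move=> f1 i0.
have /ae_eq_integral_abs : measurable_fun setT (EFin \o f).
  by apply/measurable_EFinP; exact: L1_measurable.
move=> /(_ mu measurableT) [+ _].
have := int_fin (L1_norm f1); rewrite i0 => e /(_ e).
by apply: filterS => x /(_ I)[].
Qed.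

Lemma dominated_cvg_int (f_ : nat -> T -> R) f g :
  (forall k, measurable_fun setT (f_ k)) -> L1 g ->
  (forall x, f_ ^~ x @ \oo --> f x) -> (forall k x, `|f_ k x| <= g x) ->
  L1 f /\ \int[mu]_x f_ k x @[k --> \oo] --> \int[mu]_x f x.
Proof.
move=> mf g1 fc fg.
have mlim : measurable_fun setT f by apply: measurable_fun_cvg => // x _; exact: fc.
have [] := @dominated_convergence _ _ _ mu setT measurableT
  (fun k x => (f_ k x)%:E) (EFin \o f) (EFin \o g).
- by move=> k; exact/measurable_EFinP.
- exact/measurable_EFinP.
- by apply/aeW => x _; apply/fine_cvgP; split; [exact: nearW|exact: fc].
- exact: g1.
- by apply/aeW => x k _ /=; rewrite lee_fin.
move=> f1 _ h; split => //; apply: fine_cvg.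
by rewrite -(int_fin f1).
Qed.

End real_integral.
Notation L1 mu f := (mu.-integrable setT (EFin \o f)).

(** * Open sets and continuous functions are measurable for the product sigma-algebra *)

Section row_topology.
Context {R : realType} {n : nat}.
Local Notation rV := 'rV[R]_n.
Local Notation mu := (@lebesgue_row R n).

Lemma near_rowP (x : rV) (P : rV -> Prop) :
  (\forall y \near x, P y) <->
  exists2 e : R, 0 < e & forall y : rV, (forall i, `|y ord0 i - x ord0 i| < e) -> P y.
Proof.
split=> [/nbhs_ballP[e /= e0 H]|[e e0 H]].
  exists e => // y xy; apply: H; split => // i j.
  by rewrite (ord1 i) /ball /= distrC.
apply/nbhs_ballP; exists e => //= y [_ xy]; apply: H => i.
by have := xy ord0 i; rewrite /ball /= distrC.
Qed.

(** An open set is the union of the rational boxes inside it, and these are countably many. *)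
Lemma open_measurable_row (U : set rV) : open U -> measurable U.
Proof.
move=> oU.
pose box (p : 'rV[rat]_n * nat) :=
  [set x : rV | forall i, `|x ord0 i - ratr (p.1 ord0 i)| < p.2.+1%:R^-1].
have mbox p : measurable (box p).
  rewrite (_ : box p = \bigcap_(i in [set: 'I_n])
      (row_coord i @^-1` [set t : R | `|t - ratr (p.1 ord0 i)| < p.2.+1%:R^-1])).
    apply: fin_bigcap_measurable => [|i _]; first exact: finite_finset.
    rewrite -[X in measurable X]setTI; apply: measurable_row_coord => //.
    apply: open_measurable.
    have := @ball_open R R (ratr (p.1 ord0 i)) p.2.+1%:R^-1.
    rewrite (_ : ball _ _ = [set t : R | `|t - ratr (p.1 ord0 i)| < p.2.+1%:R^-1]).
      by apply; rewrite invr_gt0.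
    by apply/seteqP; split => t /=; rewrite /ball/= distrC.
  by apply/seteqP; split => [x Bx i _|x Bx i]; [exact: Bx|exact: (Bx i I)].
rewrite (_ : U = \bigcup_(p in [set: 'rV[rat]_n * nat])
   (if pselect (box p `<=` U) then box p else set0)).
  apply: countable_bigcupT_measurable => [|p]; first exact: countableP.
  by case: pselect => ?; [exact: mbox|exact: measurable0].
apply/seteqP; split => [x Ux|x [p _]]; last by case: pselect => // h /h.
have /near_rowP[e e0 H] : \forall y \near x, U y by exact: open_nbhs_nbhs.
(* Half of [e], because [x] and another point of the box are compared through the centre of the
   box. *)
have [m mh] : exists m, m.+1%:R^-1 < e / 2.
  have e20 : 0 < e / 2 by rewrite divr_gt0.
  exists (Num.truncn (e / 2)^-1); rewrite invf_plt ?posrE//.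
  by rewrite truncnS_gt.
have m0 : 0 < m.+1%:R^-1 :> R by rewrite invr_gt0.
have hq i : {q : rat | `|x ord0 i - ratr q| < m.+1%:R^-1}.
  apply: cid; have /rat_in_itvoo[q] : x ord0 i - m.+1%:R^-1 < x ord0 i + m.+1%:R^-1.
    by rewrite ltrD2l (lt_trans _ m0)// oppr_lt0.
  by rewrite in_itv/= => h; exists q; rewrite ltr_distlC.
exists (\row_i sval (hq i), m) => //; case: pselect => [h|h].
  by move=> i /=; rewrite mxE; exact: (svalP (hq i)).
case: h => y yb; apply: H => i; have := yb i; rewrite /= mxE => h1.
have h2 := svalP (hq i).
rewrite (_ : _ - _ = (y ord0 i - ratr (sval (hq i))) - (x ord0 i - ratr (sval (hq i)))).
  apply: le_lt_trans (ler_normB _ _) _.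
  by apply: lt_trans (ltrD h1 h2) _; rewrite [ltRHS]splitr ltrD.
by ring.
Qed.

Lemma continuous_measurable_row (f : rV -> R) :
  continuous f -> measurable_fun setT f.
Proof.
move=> cf; apply: (measurability _ (RGenInftyO.measurableE R)) => _ [_ [a ->] <-].
rewrite setTI; apply: open_measurable_row; apply: open_comp => //.
Qed.

End row_topology.

(** * Smooth functions separate integrable functions *)

Section smooth_density.
Context {R : realType} {n : nat}.
Local Notation rV := 'rV[R]_n.
Local Notation mu := (@lebesgue_row R n).
Implicit Types (g psi : rV -> R) (A : set rV) (a x : rV).

(** Orthants form a pi-system under coordinatewise minima, and with one inequality per coordinate
    their indicators are limits of products of one-variable flat functions. *)
Definition orthant a : set rV := [set x | forall i, x ord0 i < a ord0 i].

Definition orthants : set (set rV) := range orthant.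

Lemma setI_closed_orthants : setI_closed orthants.
Proof.
move=> _ _ [a _ <-] [b _ <-].
exists (\row_i Num.min (a ord0 i) (b ord0 i)) => //.
apply/seteqP; split => [x xab|x [xa xb] i].
  by split => i; have := xab i; rewrite mxE lt_min => /andP[].
by rewrite mxE lt_min xa xb.
Qed.

Lemma measurable_orthants A : measurable A -> <<s orthants >> A.
Proof.
apply: smallest_sub; first exact: smallest_sigma_algebra.
rewrite -bigcup_seq; apply: bigcup_sub => i _ _ [B mB <-]; rewrite setTI.
have : <<s @RGenInftyO.G R >> B by rewrite -[X in X B](RGenInftyO.measurableE R).
move: B {mB}.
suff : <<s @RGenInftyO.G R >> `<=` [set B | <<s orthants >> (row_coord i @^-1` B)] by exact.
apply: smallest_sub.
  split => /=.
  - by rewrite preimage_set0; exact: sigma_algebra0.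
  - by move=> B mB; rewrite setTD preimage_setC -setTD; exact: sigma_algebraCD.
  - by move=> F mF; rewrite preimage_bigcup; exact: sigma_algebra_bigcup.
move=> _ [t ->] /=.
(* A half-space is the union of orthants whose other bounds grow to infinity. *)
rewrite (_ : _ @^-1` _ =
    \bigcup_k orthant (\row_j if j == i then t else k%:R)).
  apply: sigma_algebra_bigcup => k; apply: sub_sigma_algebra.
  by eexists.
apply/seteqP; split => [x /=|x [k _ /(_ i)]]; last first.
  by rewrite mxE eqxx /= in_itv.
rewrite in_itv/= => xt.
have [k hk] : exists k : nat, forall j, x ord0 j < k%:R.
  exists (\max_j Num.truncn (x ord0 j)).+1 => j.
  apply: lt_le_trans (truncnS_gt _) _.
  by rewrite ler_nat ltnS; exact: leq_bigmax.
by exists k => // j; rewrite mxE; case: eqP => [->|].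
Qed.

(* The sets whose indicator is a limit of smooth functions with values in [0, 1], in
   the L1 norm weighted by [g]: a lambda-system containing the pi-system of orthants. *)
Definition approximable g : set (set rV) := [set A | measurable A /\
  forall e : R, 0 < e -> exists psi, [/\ is_Coo psi,
    (forall x, 0 <= psi x <= 1) &
    \int[mu]_x (`|\1_A x - psi x| * `|g x|) < e]].

Lemma is_Coo_continuous psi : is_Coo psi -> continuous psi.
Proof. by move=> /(_ 0%N) []. Qed.

Lemma is_Coo_measurable psi : is_Coo psi -> measurable_fun setT psi.
Proof. by move=> /is_Coo_continuous; exact: continuous_measurable_row. Qed.

Lemma L1_approx g A psi : L1 mu g -> measurable A -> measurable_fun setT psi ->
  (forall x, 0 <= psi x <= 1) -> L1 mu (fun x => `|\1_A x - psi x| * `|g x|).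
Proof.
move=> g1 mA mpsi psi01; apply: (L1_dom _ g1).
  apply: measurable_funM.
    by apply: measurableT_comp => //; apply: measurable_funB => //; exact: measurable_indic.
  by apply: measurableT_comp => //; exact: L1_measurable g1.
move=> x; rewrite normrM !normr_id ler_piMl//.
have /andP[p0 p1] := psi01 x.
by rewrite indicE; case: (_ \in _) => /=; rewrite ler_norml; apply/andP; split; lra.
Qed.

Lemma approximable_orthant g a : L1 mu g -> approximable g (orthant a).
Proof.
move=> g1.
have oE x : x \in orthant a = [forall i, x ord0 i < a ord0 i].
  apply/idP/forallP; [by rewrite inE|by move=> h; rewrite inE].
have mO : measurable (orthant a).
  rewrite (_ : orthant a = \bigcap_(i in [set: 'I_n])
      (row_coord i @^-1` `]-oo, a ord0 i[)).
    apply: fin_bigcap_measurable => [|i _]; first exact: finite_finset.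
    by rewrite -[X in measurable X]setTI; exact: measurable_row_coord.
  apply/seteqP; split => [x h i _ /=|x h i]; first by rewrite in_itv/=; exact: h.
  by have := h i I; rewrite /= in_itv.
(* Inside the orthant this is [exp(-S/(k+1))] with [S] the sum of the [1/(a_i - x_i)], which tends
   to 1; outside, some factor is 0. *)
pose psi (k : nat) x := \prod_(i < n) flat 1 (k.+1%:R * (a ord0 i - x ord0 i)).
have flat01 (s : R) : 0 <= flat 1 s <= 1.
  rewrite /flat; case: ifPn => s0; last by rewrite lexx ler01.
  by rewrite hornerC mul1r expR_ge0 expR_le1 oppr_le0 invr_ge0 ltW.
have psi01 k x : 0 <= psi k x <= 1.
  apply/andP; split; first apply: prodr_ge0 => i _.
    by case/andP: (flat01 (k.+1%:R * (a ord0 i - x ord0 i))).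
  by apply: numdomain.Num.Theory.prodr_ile1 => i _; exact: flat01.
have Cpsi k : is_Coo (psi k).
  move=> l; apply: is_Ck_prod => j; apply: is_Ck_flat; apply: is_CkZ.
  by apply: is_CkD; [exact: is_Ck_cst|apply: is_CkN; exact: is_Ck_coord].
split => // e e0.
have cv x : psi k x @[k --> \oo] --> (\1_(orthant a) x : R).
  rewrite indicE; case: (boolP (x \in _)); rewrite oE.
    move=> /forallP xa; rewrite /=.
    have E k : psi k x = expR (- (k.+1%:R^-1 * \sum_i (a ord0 i - x ord0 i)^-1)).
      rewrite mulr_sumr -sumrN expR_sum; apply: eq_bigr => i _.
      have h : 0 < a ord0 i - x ord0 i by rewrite subr_gt0.
      by rewrite /flat mulr_gt0// hornerC mul1r invfM.
    under eq_fun do rewrite E.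
    set S := \sum_i _.
    have h1 : k.+1%:R^-1 * S @[k --> \oo] --> (0 : R).
      by have := cvgMr_tmp (b := S) (@cvg_harmonic R); rewrite mul0r; exact.
    have h2 : - (k.+1%:R^-1 * S) @[k --> \oo] --> (0 : R).
      by have := cvgN h1; rewrite oppr0; exact.
    have : expR (- (k.+1%:R^-1 * S)) @[k --> \oo] --> expR (0 : R).
      by apply: continuous_cvg h2; exact: continuous_expR.
    by rewrite expR0; exact.
  rewrite negb_forall => /existsP[i]; rewrite -leNgt => xa.
  rewrite (_ : (fun k => _) = cst 0); first exact: cvg_cst.
  apply/funext => k; rewrite /psi (bigD1 i)//= flat_le0 ?mul0r//.
  by rewrite mulr_ge0_le0// subr_le0.
have mpsi k : measurable_fun setT (psi k) by exact: is_Coo_measurable.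
have [] := @dominated_cvg_int _ _ _ mu (fun k x => `|\1_(orthant a) x - psi k x| * `|g x|)
  (cst 0) (fun x => `|g x|).
- by move=> k; apply: L1_measurable; exact: L1_approx.
- exact: L1_norm.
- move=> x /=.
  have h1 : \1_(orthant a) x - psi k x @[k --> \oo] --> (\1_(orthant a) x - \1_(orthant a) x : R).
    by apply: cvgB (cv x); exact: cvg_cst.
  have h2 : `|\1_(orthant a) x - psi k x| @[k --> \oo] -->
      `|\1_(orthant a) x - \1_(orthant a) x : R|.
    exact: cvg_norm h1.
  by have := cvgMr_tmp (b := `|g x|) h2; rewrite subrr normr0 mul0r; exact.
- move=> k x; rewrite normrM !normr_id ler_piMl//.
  have /andP[p0 p1] := psi01 k x.
  by rewrite indicE; case: (_ \in _) => /=; rewrite ler_norml; apply/andP; split; lra.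
rewrite Rintegral_cst// mul0r => _ /cvgrPdist_lt /(_ _ e0)[k _ /(_ k (leqnn k))].
rewrite sub0r normrN => h; exists (psi k); split => //.
exact: le_lt_trans (ler_norm _) h.
Qed.

Lemma approximable_lambda_system g : L1 mu g -> lambda_system setT (approximable g).
Proof.
move=> g1; split => //.
- split => // e e0; exists (cst 1); split.
  + by move=> k; exact: is_Ck_cst.
  + by move=> x; rewrite ler01 lexx.
  + under eq_Rintegral do rewrite indicT subrr normr0 mul0r.
    by rewrite Rintegral_cst// mul0r.
- move=> A B BA [mA hA] [mB hB]; split; first exact: measurableD.
  move=> e e0; have e20 : 0 < e / 2 by rewrite divr_gt0.
  have [p [Cp p01 pe]] := hA _ e20; have [q [Cq q01 qe]] := hB _ e20.
  (* The error splits as [(1_A - p)(1 - q) - 1_A (1_B - q)], so the two given errors add up. *)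
  exists (fun x => p x * (1 - q x)); split.
  + move=> k; apply: is_CkM => //; apply: is_CkD; first exact: is_Ck_cst.
    exact: is_CkN.
  + move=> x; have /andP[? ?] := p01 x; have /andP[? ?] := q01 x.
    by apply/andP; split; nra.
  + rewrite [ltRHS]splitr; apply: le_lt_trans (ltrD pe qe).
    have mp := is_Coo_measurable Cp; have mq := is_Coo_measurable Cq.
    rewrite -intD; [|exact: L1_approx..].
    have mpq : measurable_fun setT (fun x => p x * (1 - q x)).
      by apply: measurable_funM => //; apply: measurable_funB.
    apply: int_le.
    * apply: L1_approx => //; first exact: measurableD.
      move=> x; have /andP[? ?] := p01 x; have /andP[? ?] := q01 x.
      by apply/andP; split; nra.
    * by apply: L1D; exact: L1_approx.
    * move=> x; rewrite -mulrDl ler_wpM2r//.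
      rewrite !indicE in_setD.
      have /andP[? ?] := p01 x; have /andP[? ?] := q01 x.
      rewrite (_ : (_ && _)%:R - _ = ((x \in A)%:R - p x) * (1 - q x) +
         (x \in A)%:R * - ((x \in B)%:R - q x)).
        apply: le_trans (ler_normD _ _) _; rewrite !normrM normrN.
        rewrite lerD// ?ler_piMr// ?ler_piMl//; first by rewrite ger0_norm; lra.
        by case: (x \in A); rewrite ?normr1 ?normr0.
      by case: (x \in A); case: (x \in B) => /=; ring.
- move=> F ndF hF.
  have mF k : measurable (F k) by have [] := hF k.
  have mU : measurable (\bigcup_k F k) by exact: bigcupT_measurable.
  split => // e e0; have e20 : 0 < e / 2 by rewrite divr_gt0.
  (* At each point the indicators of the [F k] are eventually those of the union, so a single [F k]
     approximates the union within [e / 2]. *)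
  have [] := @dominated_cvg_int _ _ _ mu
    (fun k x => `|\1_(\bigcup_k F k) x - \1_(F k) x| * `|g x|)
    (cst 0) (fun x => `|g x|).
  + move=> k; apply: L1_measurable; apply: L1_approx => // x.
    by rewrite indicE; case: (_ \in _); rewrite ?lexx ?ler01.
  + exact: L1_norm.
  + move=> x /=.
    have h0 : (cst 0 : nat -> R) @ \oo --> (0 : R) by exact: cvg_cst.
    apply: cvg_trans h0.
    apply: near_eq_cvg.
    have [[k _ Fk]|NF] := pselect ((\bigcup_k F k) x).
      near=> l; rewrite /= !indicE !mem_set ?subrr ?normr0 ?mul0r//.
        have /subsetPset : (F k <= F l)%O by apply: ndF; near: l; exact: nbhs_infty_ge.
        by apply.
      by exists k.
    near=> l; rewrite /= !indicE !memNset ?subrr ?normr0 ?mul0r//.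
    by move=> Fl; apply: NF; exists l.
  + move=> k x; rewrite normrM !normr_id ler_piMl// !indicE.
    by case: (_ \in _); case: (_ \in _); rewrite ?subrr ?subr0 ?sub0r ?normrN ?normr0 ?normr1.
  rewrite Rintegral_cst// mul0r => _ /cvgrPdist_lt /(_ _ e20)[k _ /(_ k (leqnn k))].
  rewrite sub0r normrN => /(le_lt_trans (ler_norm _)) h.
  have [_ /(_ _ e20)[p [Cp p01 pe]]] := hF k.
  have mp := is_Coo_measurable Cp.
  exists p; split => //; rewrite [ltRHS]splitr; apply: le_lt_trans (ltrD h pe).
  have L1' : L1 mu (fun x => `|\1_(\bigcup_k F k) x - \1_(F k) x| * `|g x|).
    by apply: L1_approx => // x; rewrite indicE; case: (_ \in _); rewrite ?lexx ?ler01.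
  rewrite -intD//; last exact: L1_approx.
  apply: int_le; first exact: L1_approx.
    by apply: L1D => //; exact: L1_approx.
  by move=> x; rewrite -mulrDl ler_wpM2r//; exact: ler_distD.
Unshelve. all: by end_near. Qed.

Lemma smooth_approximation g A : L1 mu g -> measurable A -> approximable g A.
Proof.
move=> g1 /measurable_orthants; apply: lambda_system_subset => //.
- exact: setI_closed_orthants.
- exact: approximable_lambda_system.
- by move=> _ [a _ <-]; exact: approximable_orthant.
Qed.

(** With [psi] close to the indicator of [N = {g < 0}], the integral of [|g|] over [N] is at most
    that of [g psi - g 1_N], which the approximation makes as small as desired. *)
Lemma smooth_tests_ge0 g : L1 mu g ->
  (forall psi, is_Coo psi -> (forall x, 0 <= psi x <= 1) ->
    0 <= \int[mu]_x (g x * psi x)) ->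
  {ae mu, forall x, 0 <= g x}.
Proof.
move=> g1 H; have mg := L1_measurable g1.
pose N := [set x | g x < 0].
have mN : measurable N.
  have := mg measurableT _ (measurable_itv `]-oo, 0[); rewrite setTI.
  by congr measurable; apply/seteqP; split => x /=; rewrite in_itv.
have b01 x : `|\1_N x : R| <= 1 by rewrite indicE; case: (_ \in _); rewrite ?normr1 ?normr0.
have gN1 : L1 mu (fun x => g x * \1_N x).
  by apply: (L1M_bounded g1 _ b01); exact: measurable_indic.
have NE x : `|g x * \1_N x| = - (g x * \1_N x).
  rewrite indicE; case: (boolP (x \in N)) => [|_]; last by rewrite mulr0 normr0 oppr0.
  by rewrite inE => gx; rewrite mulr1 ltr0_norm.
have i0 : \int[mu]_x `|g x * \1_N x| = 0.
  apply/eqP; rewrite eq_le; apply/andP; split; last exact: int_ge0.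
  apply/ler_addgt0Pr => e e0; rewrite add0r.
  have [_ /(_ _ e0)[p [Cp p01 pe]]] := smooth_approximation g1 mN.
  have mp := is_Coo_measurable Cp.
  have gp1 : L1 mu (fun x => g x * p x).
    apply: (L1M_bounded (C := 1) g1) => // x.
    by have /andP[? ?] := p01 x; rewrite ler_norml; apply/andP; split; lra.
  apply: le_trans (ltW pe); rewrite -[leLHS]addr0.
  apply: le_trans (lerD (lexx _) (H p Cp p01)) _.
  rewrite -intD//; last exact: L1_norm.
  apply: int_le; first by apply: L1D => //; exact: L1_norm.
    exact: L1_approx.
  move=> x; rewrite NE -normrM (_ : _ + _ = - ((\1_N x - p x) * g x)); last by ring.
  by rewrite -[leRHS]normrN ler_norm.
have := int_norm_eq0 gN1 i0; apply: filterS => x.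
rewrite indicE; case: (boolP (x \in N)) => [|].
  by rewrite mulr1 => _ ->.
by rewrite notin_setE => /negP; rewrite -leNgt.
Qed.

End smooth_density.

(** * Integration by parts *)

Section bounded_support.
Context {R : realType} {n : nat}.
Local Notation rV := 'rV[R]_n.
Local Notation mu := (@lebesgue_row R n).
Implicit Types (f g df : rV -> R).

Definition cube (L : R) : set rV := [set x | forall i, x ord0 i \in `[- L, L]].

Definition support_in_cube (L : R) f := forall x, ~ cube L x -> f x = 0.

Lemma measurable_cube L : measurable (cube L).
Proof.
rewrite (_ : cube L = \bigcap_(i in [set: 'I_n]) (row_coord i @^-1` `[- L, L])).
  apply: fin_bigcap_measurable => [|i _]; first exact: finite_finset.
  by rewrite -[X in measurable X]setTI; exact: measurable_row_coord.
by apply/seteqP; split => [x h i _|x h i]; [exact: h|exact: h].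
Qed.

Lemma cube_lty L : (mu (cube L) < +oo)%E.
Proof.
rewrite (lebesgue_row_box (A := fun=> `[- L, L]%classic)) => [|i //].
set p := (\prod_(i < n) _)%E; suff /fineK <- : p \is a fin_num by exact: ltry.
rewrite /p; elim/big_ind: _ => // [x y|i _]; first exact: fin_numM.
by rewrite lebesgue_measure_itv; case: ifP.
Qed.

Lemma L1_indic_cube L : L1 mu (\1_(cube L) : rV -> R).
Proof.
apply/integrableP; split.
  by apply/measurable_EFinP; apply: measurable_indic; exact: measurable_cube.
under eq_integral do rewrite /= ger0_norm//.
rewrite integral_indic//; first by rewrite setIT; exact: cube_lty.
exact: measurable_cube.
Qed.

Lemma L1_support_in_cube L C f : measurable_fun setT f ->
  support_in_cube L f -> (forall x, `|f x| <= C) -> L1 mu f.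
Proof.
move=> mf sf fC; apply: (L1_dom mf (L1Z C (L1_indic_cube L))) => x.
rewrite indicE; case: (boolP (x \in cube L)) => [_|].
  by rewrite mulr1; exact: le_trans (fC x) (ler_norm _).
by rewrite notin_setE => /sf ->; rewrite normr0.
Qed.

Lemma compact_cube L : compact (cube L).
Proof.
have := @rV_compact R n (fun=> `[- L, L]%classic).
by apply=> _; exact: segment_compact.
Qed.

Lemma continuous_bounded_cube L f : continuous f -> exists2 C : R, 0 <= C &
  forall x, cube L x -> `|f x| <= C.
Proof.
move=> cf; have [M [_ hM]] : bounded_set (f @` cube L).
  apply: compact_bounded; apply: continuous_compact; last exact: compact_cube.
  by apply: continuous_subspaceT.
exists (`|M| + 1); first by rewrite addr_ge0.
by move=> x cx; apply: (hM (`|M| + 1)); [rewrite ltr_pwDr// ler_norm|exists x].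
Qed.

Lemma L1_continuous_support L f : continuous f -> support_in_cube L f -> L1 mu f.
Proof.
move=> cf sf; have [C C0 hC] := continuous_bounded_cube L cf.
apply: (L1_support_in_cube (C := C) _ sf); first exact: continuous_measurable_row.
by move=> x; have [/hC//|/sf ->] := pselect (cube L x); rewrite normr0.
Qed.

(** The complement of the closed cube is open, so [f] vanishes near each of its points and the cube
    need not grow. *)
Lemma support_in_cube_partial L i f df :
  has_partial i f df -> support_in_cube L f -> support_in_cube L df.
Proof.
move=> hf sf x nx.
have /existsNP[j /negP hj] : ~ forall j, x ord0 j \in `[- L, L] by exact: nx.
have h0 : {near x, (cst 0 : rV -> R) =1 f}.
  have hA : nbhs (x ord0 j) (~` `[- L, L]).
    by apply: open_nbhs_nbhs; split; [exact/closed_openC/itv_closed|exact/negP].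
  have hx : nbhs x ((fun M : rV => M ord0 j) @^-1` (~` `[- L, L])).
    exact: (@coord_continuous R 1 n ord0 j x _ hA).
  apply: filterS hx => y yj; by rewrite /= sf// => /(_ j); exact: yj.
have := hf x => -[_ <-].
rewrite -(near_eq_derive (delta_mx ord0 i) h0).
exact: derive_cst.
Qed.

End bounded_support.

(** * Partial derivatives of functions with bounded support integrate to 0 *)

Section divergence_theorem.
Context {R : realType}.

Lemma int_derive_bounded_support (F dF : R -> R) (L : R) : 0 < L ->
  continuous dF -> (forall t : R, is_derive t 1 F (dF t)) ->
  (forall t, t \notin `[- L, L] -> F t = 0) ->
  (\int[lebesgue_measure]_t (dF t)%:E = 0)%E.
Proof.
move=> L0 cdF hF sF.
have cF : continuous F.
  by move=> t; apply: differentiable_continuous; apply/derivable1_diffP; have [] := hF t.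
have sdF t : t \notin `[- (L + 1), L + 1] -> dF t = 0.
  move=> tL.
  have h0 : {near t, (cst 0 : R -> R) =1 F}.
    have : nbhs t (~` `[- L, L]).
      apply: open_nbhs_nbhs; split; first exact/closed_openC/itv_closed.
      move=> /= h; move/negP: tL; apply; move: h; rewrite !in_itv/= => /andP[h1 h2].
      by apply/andP; split; lra.
    by apply: filterS => s sL; rewrite sF//; exact/negP.
  have := hF t => -[_ <-].
  by rewrite -(near_eq_derive (1 : R) h0); exact: derive_cst.
(* The interval is enlarged by 1 because [F] is known to vanish only strictly outside [[-L, L]], and
   it has to vanish at both endpoints. *)
have ab : - (L + 1) < L + 1 by lra.
have := @continuous_FTC2 R dF F (- (L + 1)) (L + 1) ab.
rewrite sF; last by rewrite in_itv/=; apply/negP => /andP[]; lra.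
rewrite sF; last by rewrite in_itv/=; apply/negP => /andP[]; lra.
rewrite subee// => <-.
- rewrite [RHS]integral_mkcond; apply: eq_integral => t _.
  rewrite patchE; case: ifPn => //; rewrite mem_setE => /sdF -> //.
- exact: continuous_subspaceT.
- split.
  + by move=> x _; have [] := hF x.
  + exact: cvg_at_right_filter (cF _).
  + exact: cvg_at_left_filter (cF _).
- by move=> x _; rewrite derive1E; have [_ ->] := hF x.
Qed.

Section row_cons_calculus.
Context {n : nat}.

Lemma row_consE (t : R) (v : 'rV[R]_n) :
  row_cons (t, v) = row_cons (0, v) + t *: delta_mx ord0 ord0.
Proof.
apply/rowP => i; rewrite [in RHS]mxE; case: (unliftP ord0 i) => [j|] ->.
  by rewrite !row_consS !mxE /= mulr0 addr0.
by rewrite !row_cons0 !mxE eqxx /= mulr1 add0r.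
Qed.

Lemma row_cons_addr (t h : R) (v : 'rV[R]_n) j :
  row_cons (t, h *: delta_mx ord0 j + v) =
  h *: delta_mx ord0 (lift ord0 j) + row_cons (t, v).
Proof.
apply/rowP => i; rewrite [in RHS]mxE; case: (unliftP ord0 i) => [k|] ->.
  by rewrite !row_consS !mxE (inj_eq lift_inj).
by rewrite !row_cons0 !mxE /= mulr0 add0r.
Qed.

Lemma continuous_row_cons_l (f : 'rV[R]_n.+1 -> R) v :
  continuous f -> continuous (fun t => f (row_cons (t, v))).
Proof.
move=> cf t; apply: continuous_comp; last exact: cf.
move=> A /near_rowP[e e0 H].
exists e => //= s; rewrite /ball/= => st; apply: H => i.
case: (unliftP ord0 i) => [j|] ->; first by rewrite !row_consS subrr normr0.
by rewrite !row_cons0 distrC.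
Qed.

Lemma continuous_row_cons_r (f : 'rV[R]_n.+1 -> R) t :
  continuous f -> continuous (fun v => f (row_cons (t, v))).
Proof.
move=> cf v; apply: continuous_comp; last exact: cf.
move=> A /near_rowP[e e0 H].
apply/near_rowP; exists e => // w wv; apply: H => i.
case: (unliftP ord0 i) => [j|] ->; first by rewrite !row_consS.
by rewrite !row_cons0 subrr normr0.
Qed.

Lemma has_partial_row_cons j (f df : 'rV[R]_n.+1 -> R) t :
  has_partial (lift ord0 j) f df ->
  has_partial j (fun v => f (row_cons (t, v))) (fun v => df (row_cons (t, v))).
Proof.
move=> hf v; have [d1 d2] := hf (row_cons (t, v)).
have e : (fun h : R => h^-1 *: (((fun v => f (row_cons (t, v))) \o shift v) (h *: delta_mx ord0 j)
    - f (row_cons (t, v)))) =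
   (fun h : R => h^-1 *: ((f \o shift (row_cons (t, v))) (h *: delta_mx ord0 (lift ord0 j)) -
    f (row_cons (t, v)))).
  by apply/funext => h /=; rewrite row_cons_addr.
apply: DeriveDef; first by rewrite /derivable e.
by rewrite /derive e.
Qed.

(** [lebesgue_row n.+1] is by definition the image of the product measure under [row_cons]; this
    opens the way to Fubini. *)
Lemma int_row_cons (f : 'rV[R]_n.+1 -> R) : L1 (lebesgue_row n.+1) f ->
  ((lebesgue_measure \x lebesgue_row n)%E).-integrable setT
    (fun p => (f (row_cons p))%:E) /\
  (\int[lebesgue_row n.+1]_x (f x)%:E =
   \int[lebesgue_measure \x lebesgue_row n]_p (f (row_cons p))%:E)%E.
Proof.
move=> f1; have mf := L1_measurable f1.
have mfr : measurable_fun setT (f \o @row_cons R n).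
  exact: measurableT_comp mf (@measurable_row_cons R n).
have i1 : ((lebesgue_measure \x lebesgue_row n)%E).-integrable setT
    (fun p => (f (row_cons p))%:E).
  apply/integrableP; split; first exact/measurable_EFinP.
  have /integrableP[_] := f1; apply: le_lt_trans.
  rewrite [leRHS](ge0_integral_pushforward (@measurable_row_cons R n)
    ((lebesgue_measure \x lebesgue_row n)%E : {measure set _ -> \bar R}))//.
  by apply: measurableT_comp => //; exact/measurable_EFinP.
split => //.
apply: (integral_pushforward (@measurable_row_cons R n)
  (mu := (lebesgue_measure \x lebesgue_row n)%E : {measure set _ -> \bar R}) (D := setT)
  (f := EFin \o f)) => //.
exact/measurable_EFinP.
Qed.

End row_cons_calculus.

(** Fubini in the order that suits the direction: for the first coordinate the inner integral runs
    along lines and vanishes by the fundamental theorem of calculus; for a later one it runs over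
    slices and vanishes by induction on the dimension. *)
Lemma int_partial0 n (i : 'I_n) (f df : 'rV[R]_n -> R) L : 0 < L ->
  has_partial i f df -> continuous df -> support_in_cube L f ->
  (\int[lebesgue_row n]_x (df x)%:E = 0)%E.
Proof.
move=> L0; elim: n i f df => [[]//|n IH] i f df hf cdf sf.
have sdf := support_in_cube_partial hf sf.
have [i1 ->] := int_row_cons (L1_continuous_support cdf sdf).
case: (unliftP ord0 i) hf => [j|] -> hf.
- rewrite -integral12_prod_meas1//.
  apply: integral0_eq => t _; rewrite /fubini_F.
  apply: (IH j _ _ (has_partial_row_cons t hf)).
    exact: continuous_row_cons_r.
  move=> v nv; apply: sf => h; apply: nv => k.
  by have := h (lift ord0 k); rewrite row_consS.
- rewrite -integral21_prod_meas1//.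
  apply: integral0_eq => v _; rewrite /fubini_G.
  apply: (@int_derive_bounded_support (fun t => f (row_cons (t, v))) _ L L0).
  + exact: continuous_row_cons_l.
  + move=> t; have := is_derive_line (row_cons (0, v)) t hf.
    under eq_fun do rewrite -row_consE.
    by rewrite -row_consE.
  + move=> t tL; apply: sf => /(_ ord0); rewrite row_cons0; exact/negP.
Qed.

End divergence_theorem.

(** * Test functions in the unit ball *)

Section unit_ball_tests.
Context {R : realType} {n : nat}.
Local Notation rV := 'rV[R]_n.
Local Notation mu := (@lebesgue_row R n).
Implicit Types (f g h u phi psi : rV -> R) (i : 'I_n) (x : rV) (rho : R).

Lemma sqnE x : sqn x = \sum_i x ord0 i ^+ 2.
Proof. by apply: eq_bigr => i _; rewrite mxE subr0. Qed.

Lemma B1E x : B1 x <-> sqn x < 1.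
Proof.
rewrite /B1 /= /enorm -sqnE; suff -> : (Num.sqrt (sqn x) < 1) = (sqn x < 1) by [].
by rewrite -{1}[1 : R]sqrtr1 ltr_sqrt.
Qed.

Lemma coord_le_sqdist (c : rV) x i : (x ord0 i - c ord0 i) ^+ 2 <= sqdist c x.
Proof.
rewrite /sqdist (bigD1 i)//= lerDl; apply: sumr_ge0 => j _; exact: sqr_ge0.
Qed.

Lemma sqn_cube x : sqn x <= 1 -> cube 1 x.
Proof.
move=> x1 i; have := le_trans (coord_le_sqdist 0 x i) x1.
by rewrite mxE subr0 in_itv/= => h; apply/andP; split; nra.
Qed.

Lemma continuous_sqn : continuous (sqdist (0 : rV)).
Proof. exact: is_Ck_continuous (is_Ck_sqdist 0 0). Qed.

Lemma open_B1 : open (B1 : set rV).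
Proof.
rewrite (_ : B1 = sqdist 0 @^-1` [set t : R | t < 1]).
  by apply: open_comp => [x _|]; [exact: continuous_sqn|exact: open_lt].
by apply/seteqP; split => x /B1E.
Qed.

Lemma measurable_B1 : measurable (B1 : set rV).
Proof. by apply: open_measurable_row; exact: open_B1. Qed.

(** A quantitative form of compact support: for [rho < 1] it leaves a gap to the sphere. Note that
    [rho] is a squared radius. *)
Definition supp_within rho f := forall x, rho < sqn x -> f x = 0.

Lemma supp_within_test rho phi : rho < 1 -> is_Coo phi -> supp_within rho phi ->
  test_function phi.
Proof.
move=> rho1 Cphi sphi; split => //.
have cl : closure [set x | phi x != 0] `<=` [set x | sqn x <= rho].
  rewrite [X in _ `<=` X](_ : _ = closure [set x | sqn x <= rho]).
    apply: closure_subset => x /=; apply: contraNT; rewrite -ltNge => /sphi ->.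
    exact: eqxx.
  apply/closure_id.
  apply: (@closed_comp _ _ (sqdist 0) [set t : R | t <= rho]) => [x _|].
    exact: continuous_sqn.
  exact: closed_le.
split; last by move=> x /cl /= h; apply/B1E; exact: le_lt_trans rho1.
apply: (subclosed_compact _ (@compact_cube R n 1)); first exact: closed_closure.
by move=> x /cl /= h; apply: sqn_cube; rewrite (le_trans h)// ltW.
Qed.

(** The squared norm attains its maximum on the compact support, and that maximum is below 1; [rho]
    is the midpoint between it and 1. *)
Lemma test_supp_within phi : test_function phi ->
  exists2 rho, 0 < rho < 1 & supp_within rho phi.
Proof.
move=> [Cphi [cK KB]]; set K := closure _ in cK KB.
have [K0|/set0P/negP/negPn/eqP K0] := pselect (K !=set0); last first.
  exists (1 / 2); first by apply/andP; split; lra.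
  move=> x _; apply/eqP; rewrite -[_ == _]negbK; apply/negP => h.
  have : K x by exact: subset_closure.
  by rewrite K0.
have [c cKc cmax] := EVT_max_rV K0 cK (continuous_subspaceT continuous_sqn).
have c1 : sqn c < 1 by apply/B1E; apply: KB; rewrite inE in cKc.
have := sqdist_ge0 0 c => c0.
exists ((sqn c + 1) / 2); first by apply/andP; split; lra.
move=> x hx; apply/eqP; rewrite -[_ == _]negbK; apply/negP => h.
have : K x by exact: subset_closure.
rewrite -inE => /cmax; lra.
Qed.

Lemma test_out phi x : test_function phi -> ~ B1 x -> phi x = 0.
Proof.
move=> [Cphi [cK KB]] nx; apply/eqP; rewrite -[_ == _]negbK; apply/negP => h.
by apply/nx/KB/subset_closure.
Qed.

Lemma is_Coo_partial i f : is_Coo f ->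
  has_partial i f (partial i f) /\ is_Coo (partial i f).
Proof.
move=> Cf; split => [x|k].
  have /is_CkSP[_ /(_ i)[g hg _]] := Cf 1%N.
  by rewrite (has_partialE hg); exact: hg.
by have [_ /(_ i)[]] := Cf k.+1.
Qed.

Lemma is_CooD f g : is_Coo f -> is_Coo g -> is_Coo (fun x => f x + g x).
Proof. by move=> Cf Cg k; apply: is_CkD. Qed.

Lemma is_CooM f g : is_Coo f -> is_Coo g -> is_Coo (fun x => f x * g x).
Proof. by move=> Cf Cg k; apply: is_CkM. Qed.

Lemma is_CooZ (a : R) f : is_Coo f -> is_Coo (fun x => a * f x).
Proof. by move=> Cf k; apply: is_CkZ. Qed.

Lemma supp_within_partial rho i f df :
  has_partial i f df -> supp_within rho f -> supp_within rho df.
Proof.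
move=> hf sf x hx.
have h0 : {near x, (cst 0 : rV -> R) =1 f}.
  have hA : nbhs (sqn x) [set t : R | rho < t].
    by apply: open_nbhs_nbhs; split => //; exact: open_gt.
  have hn : nbhs x (sqdist 0 @^-1` [set t : R | rho < t]).
    exact: (@continuous_sqn x _ hA).
  by apply: filterS hn => y /= /sf ->.
have := hf x => -[_ <-].
by rewrite -(near_eq_derive (delta_mx ord0 i) h0); exact: derive_cst.
Qed.

Lemma test_partial i phi : test_function phi -> test_function (partial i phi).
Proof.
move=> tphi; have [rho /andP[_ rho1] sphi] := test_supp_within tphi.
have [hp Cp] := is_Coo_partial i tphi.1.
apply: (supp_within_test rho1) => //; exact: supp_within_partial sphi.
Qed.

Lemma testM phi f : test_function phi -> is_Coo f ->
  test_function (fun x => f x * phi x).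
Proof.
move=> tphi Cf; have [rho /andP[_ rho1] sphi] := test_supp_within tphi.
apply: (supp_within_test rho1); first by apply: is_CooM => //; exact: tphi.1.
by move=> x /sphi ->; rewrite mulr0.
Qed.

Lemma testD phi psi : test_function phi -> test_function psi ->
  test_function (fun x => phi x + psi x).
Proof.
move=> tphi tpsi; have [r1 /andP[_ r11] s1] := test_supp_within tphi.
have [r2 /andP[_ r21] s2] := test_supp_within tpsi.
apply: (@supp_within_test (Num.max r1 r2)).
- by rewrite gt_max r11 r21.
- by apply: is_CooD; [exact: tphi.1|exact: tpsi.1].
- by move=> x; rewrite gt_max => /andP[/s1 -> /s2 ->]; rewrite addr0.
Qed.

Lemma testZ (a : R) phi : test_function phi -> test_function (fun x => a * phi x).
Proof. by move=> tphi; apply: (testM tphi (f := cst a)) => k; exact: is_Ck_cst. Qed.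

Lemma test_support_in_cube phi : test_function phi -> support_in_cube 1 phi.
Proof.
move=> tphi x nx; apply: (test_out tphi) => /B1E /ltW h; apply: nx.
exact: sqn_cube.
Qed.

Lemma test_continuous phi : test_function phi -> continuous phi.
Proof. by move=> [/is_Coo_continuous]. Qed.

Lemma test_L1 phi : test_function phi -> L1 mu phi.
Proof.
by move=> tphi; apply: (L1_continuous_support (test_continuous tphi));
  exact: test_support_in_cube.
Qed.

Lemma test_bounded phi : test_function phi ->
  exists2 C : R, 0 <= C & forall x, `|phi x| <= C.
Proof.
move=> tphi; have [C C0 hC] := continuous_bounded_cube 1 (test_continuous tphi).
exists C => // x; have [/hC//|/(test_support_in_cube tphi) ->] := pselect (cube 1 x).
by rewrite normr0.
Qed.

Lemma L1M_test h phi : L1 mu h -> test_function phi -> L1 mu (fun x => h x * phi x).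
Proof.
move=> h1 tphi; have [C C0 hC] := test_bounded tphi.
apply: (L1M_bounded h1 _ hC).
by apply: continuous_measurable_row; exact: test_continuous.
Qed.

Lemma int_partial_test i phi : test_function phi -> \int[mu]_x partial i phi x = 0.
Proof.
move=> tphi; have [hp Cp] := is_Coo_partial i tphi.1.
rewrite /Rintegral (int_partial0 ltr01 hp)//; first exact: is_Coo_continuous.
exact: test_support_in_cube.
Qed.

(** A test function for [rho < 1]. [bump 1] is the [eta] of the overview: positive in the whole
    ball, with a support that reaches the boundary. *)
Definition bump rho x : R := flat 1 (rho - sqn x).

Lemma bump_Coo rho : is_Coo (bump rho).
Proof.
move=> k; apply: is_Ck_flat; apply: is_CkD; first exact: is_Ck_cst.
by apply: is_CkN; exact: is_Ck_sqdist.
Qed.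

Lemma flat1_ge0 (s : R) : 0 <= flat 1 s.
Proof. by rewrite /flat; case: ifP => // _; rewrite hornerC mul1r expR_ge0. Qed.

Lemma flat1_gt0 (s : R) : 0 < s -> 0 < flat 1 s.
Proof. by rewrite /flat => ->; rewrite hornerC mul1r expR_gt0. Qed.

Lemma bump_ge0 rho x : 0 <= bump rho x. Proof. exact: flat1_ge0. Qed.

Lemma bump_gt0 rho x : sqn x < rho -> 0 < bump rho x.
Proof. by move=> h; apply: flat1_gt0; rewrite subr_gt0. Qed.

Lemma bump_supp rho : supp_within rho (bump rho).
Proof. by move=> x h; rewrite /bump flat_le0// subr_le0 ltW. Qed.

Lemma bump_test rho : rho < 1 -> test_function (bump rho).
Proof. by move=> r1; apply: (supp_within_test r1); [exact: bump_Coo|exact: bump_supp]. Qed.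

(** Multiplication by [bump rho] turns any smooth [psi] into an admissible test function. So
    [h * bump rho] is tested against all smooth functions, and the positive factor is then
    cancelled. *)
Lemma test_ge0_ae_within h rho : L1 mu h -> rho < 1 ->
  (forall phi, test_function phi -> supp_within rho phi ->
    (forall x, 0 <= phi x) -> 0 <= \int[mu]_x (h x * phi x)) ->
  {ae mu, forall x, sqn x < rho -> 0 <= h x}.
Proof.
move=> h1 r1 H.
have : {ae mu, forall x, 0 <= h x * bump rho x}.
  apply: smooth_tests_ge0; first by apply: L1M_test => //; exact: bump_test.
  move=> psi Cpsi psi01.
  rewrite (_ : (fun x => _) = (fun x => h x * (psi x * bump rho x))); last first.
    by apply/funext => x; ring.
  apply: H; first by apply: testM => //; exact: bump_test.
    by move=> x /bump_supp ->; rewrite mulr0.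
  by move=> x; rewrite mulr_ge0 ?bump_ge0//; have /andP[] := psi01 x.
by apply: filterS => x + hx; rewrite pmulr_lge0// bump_gt0.
Qed.

(** Only countably many null sets may be united, so the ball is exhausted by the squared radii
    [1 - 1/(k+2)]; the shift by 2 keeps them positive. *)
Lemma ae_B1_exhaust (P : rV -> Prop) :
  (forall rho, 0 < rho < 1 -> {ae mu, forall x, sqn x < rho -> P x}) ->
  {ae mu, forall x, B1 x -> P x}.
Proof.
move=> H; pose r (k : nat) : R := 1 - k.+2%:R^-1.
have r01 k : 0 < r k < 1.
  have h0 : 0 < k.+2%:R^-1 :> R by rewrite invr_gt0.
  have h1 : k.+2%:R^-1 < 1 :> R by rewrite invf_lt1// ltr1n.
  by rewrite /r subr_gt0 h1 gtrBl h0.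
have /ae_foralln : forall k, {ae mu, forall x, sqn x < r k -> P x} by move=> k; exact: H.
apply: filterS => x hx /B1E x1.
have d0 : 0 < 1 - sqn x by rewrite subr_gt0.
apply: (hx (Num.truncn (1 - sqn x)^-1)).
rewrite /r ltrBrDr -ltrBrDl invf_plt ?posrE//.
by apply: lt_trans (truncnS_gt _) _; rewrite ltr_nat.
Qed.

(** The fundamental lemma of the calculus of variations, from the one-sided version applied to [h]
    and to its opposite. *)
Lemma test_eq0_ae h : L1 mu h ->
  (forall phi, test_function phi -> \int[mu]_x (h x * phi x) = 0) ->
  {ae mu, forall x, B1 x -> h x = 0}.
Proof.
move=> h1 H; apply: ae_B1_exhaust => rho /andP[_ r1].
have hp : {ae mu, forall x, sqn x < rho -> 0 <= h x}.
  by apply: test_ge0_ae_within => // phi tphi _ _; rewrite H.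
have hn : {ae mu, forall x, sqn x < rho -> 0 <= (-1) * h x}.
  apply: test_ge0_ae_within => //; first exact: L1Z.
  move=> phi tphi _ _; under eq_Rintegral do rewrite -mulrA.
  by rewrite intZ ?H ?mulr0//; exact: L1M_test.
apply: filterS2 hp hn => x hp hn hx.
by apply/eqP; rewrite eq_le hp// andbT -oppr_ge0 -mulN1r hn.
Qed.

End unit_ball_tests.

(** * Weak derivatives and the Dirichlet energy *)

Section sobolev.
Context {R : realType} {n : nat}.
Local Notation rV := 'rV[R]_n.
Local Notation mu := (@lebesgue_row R n).
Implicit Types (f g h u v phi psi : rV -> R) (i : 'I_n) (x : rV).

(** Nothing is known of an element of [H1] outside the ball; extension by 0 turns all integrals into
    integrals over the whole space. *)
Definition on_ball f : rV -> R := fun x => f x * \1_B1 x.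

Lemma on_ballE f x : B1 x -> on_ball f x = f x.
Proof. by move=> x1; rewrite /on_ball indicE mem_set// mulr1. Qed.

Lemma on_ballNE f x : ~ B1 x -> on_ball f x = 0.
Proof. by move=> x1; rewrite /on_ball indicE memNset// mulr0. Qed.

Lemma on_ball_patch f : f \_ B1 = on_ball f.
Proof. exact: patch_indic. Qed.

Lemma int_on_ball f : \int[mu]_(x in B1) f x = \int[mu]_x on_ball f x.
Proof. by rewrite Rintegral_mkcond on_ball_patch. Qed.

Lemma L1_on_ball f : mu.-integrable B1 (EFin \o f) <-> L1 mu (on_ball f).
Proof.
have mB := @measurable_B1 R n.
by rewrite -on_ball_patch -restrict_EFin; exact: integrable_mkcond.
Qed.

Lemma L2P f : L2 f <-> measurable_fun setT (on_ball f) /\ L1 mu (fun x => on_ball f x ^+ 2).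
Proof.
have mB := @measurable_B1 R n.
have e : on_ball (fun x => f x ^+ 2) = (fun x => on_ball f x ^+ 2).
  apply/funext => x; have [x1|x1] := pselect (B1 x); first by rewrite !on_ballE.
  by rewrite !on_ballNE// expr0n.
rewrite /L2 -e -L1_on_ball -on_ball_patch.
by split=> -[mf i]; split => //; apply/(measurable_restrictT f mB).
Qed.

Lemma L2M f g : L2 f -> L2 g -> L1 mu (fun x => on_ball f x * on_ball g x).
Proof.
(* Domination by [|f g| <= f^2 + g^2]. *)
move=> /L2P[mf f2] /L2P[mg g2]; apply: (L1_dom _ (L1D f2 g2)).
  exact: measurable_funM.
move=> x; rewrite normrM [leRHS]ger0_norm ?addr_ge0 ?sqr_ge0//.
rewrite -(real_normK (num_real (on_ball f x))) -(real_normK (num_real (on_ball g x))).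
have := normr_ge0 (on_ball f x); have := normr_ge0 (on_ball g x); nra.
Qed.

Lemma L2D f g : L2 f -> L2 g -> L2 (fun x => f x + g x).
Proof.
move=> Hf Hg; have fg := L2M Hf Hg; move: Hf Hg => /L2P[mf f2] /L2P[mg g2].
have e x : on_ball (fun x => f x + g x) x = on_ball f x + on_ball g x by exact: mulrDl.
apply/L2P; split; first by rewrite (funext e); apply: measurable_funD.
rewrite (_ : (fun x => _) = fun x => on_ball f x ^+ 2 + on_ball g x ^+ 2 +
   2 * (on_ball f x * on_ball g x)).
  by apply: L1D; [exact: L1D|exact: L1Z].
by apply/funext => x; rewrite e; ring.
Qed.

Lemma measurable_indic_B1 : measurable_fun setT (\1_B1 : rV -> R).
Proof. by apply: measurable_indic; exact: measurable_B1. Qed.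

Lemma measurable_on_ball f : measurable_fun setT f -> measurable_fun setT (on_ball f).
Proof. by move=> mf; apply: measurable_funM => //; exact: measurable_indic_B1. Qed.

Lemma L1_on_ball_continuous f : continuous f -> L1 mu (on_ball f).
Proof.
move=> cf; have [C C0 hC] := continuous_bounded_cube 1 cf.
apply: (@L1_support_in_cube _ _ 1 C).
- by apply: measurable_on_ball; exact: continuous_measurable_row.
- move=> x nx; apply: on_ballNE => /B1E/ltW x1; apply: nx; exact: sqn_cube.
- move=> x; have [x1|x1] := pselect (B1 x); last by rewrite on_ballNE// normr0.
  by rewrite on_ballE//; apply: hC; apply: sqn_cube; apply: ltW; exact/B1E.
Qed.

Lemma L2_continuous f : continuous f -> L2 f.
Proof.
move=> cf; apply/L2P; split.
  by apply: measurable_on_ball; exact: continuous_measurable_row.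
have : L1 mu (on_ball (fun x => f x ^+ 2)).
  apply: L1_on_ball_continuous => x; rewrite (_ : (fun x => _) = (fun x => f x * f x)).
    by apply: continuousM; exact: cf.
  by apply/funext => y; rewrite expr2.
congr (L1 mu _); apply/funext => x.
have [x1|x1] := pselect (B1 x); first by rewrite !on_ballE.
by rewrite !on_ballNE// expr0n.
Qed.

Lemma L2_L1 f : L2 f -> L1 mu (on_ball f).
Proof.
move=> Lf; have L1c : L2 (cst 1 : rV -> R) by apply: L2_continuous; exact: cst_continuous.
have := L2M Lf L1c; congr (L1 mu _); apply/funext => x.
have [x1|x1] := pselect (B1 x); first by rewrite !on_ballE// mulr1.
by rewrite !on_ballNE// mulr0.
Qed.

Lemma on_ballM f g : on_ball (fun x => f x * g x) = (fun x => on_ball f x * g x).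
Proof. by apply/funext => x; rewrite /on_ball mulrAC. Qed.

Lemma weakP i u g : is_weak_partial i u g <-> L2 g /\
  forall phi, test_function phi ->
    \int[mu]_x (on_ball u x * partial i phi x) = - \int[mu]_x (on_ball g x * phi x).
Proof.
by split=> -[Lg H]; split => // phi /H; rewrite !int_on_ball !on_ballM.
Qed.

(** Product rule for [f * phi], whose partial derivative integrates to 0 because [phi] has compact
    support. *)
Lemma weak_smooth i f : is_Coo f -> is_weak_partial i f (partial i f).
Proof.
move=> Cf; have [hf Cdf] := is_Coo_partial i Cf.
apply/weakP; split; first exact/L2_continuous/is_Coo_continuous.
move=> phi tphi; have [hphi Cdphi] := is_Coo_partial i tphi.1.
have tdphi := test_partial i tphi.
apply/eqP; rewrite -addr_eq0 -intD; first last.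
- by apply: L1M_test => //; apply: L1_on_ball_continuous; exact: is_Coo_continuous.
- by apply: L1M_test => //; apply: L1_on_ball_continuous; exact: is_Coo_continuous.
rewrite -(int_partial_test i (testM tphi Cf)) (has_partialE (has_partialM hf hphi)).
apply/eqP; congr (Rintegral mu setT _); apply/funext => x.
have [x1|x1] := pselect (B1 x); first by rewrite !on_ballE.
by rewrite (test_out tphi)// (test_out tdphi)// !mulr0.
Qed.

Lemma on_ballD f g x : on_ball (fun x => f x + g x) x = on_ball f x + on_ball g x.
Proof. exact: mulrDl. Qed.

Lemma on_ballZ (a : R) f x : on_ball (fun x => a * f x) x = a * on_ball f x.
Proof. by rewrite /on_ball mulrA. Qed.

Lemma weakD i u g v h : L2 u -> L2 v -> is_weak_partial i u g ->
  is_weak_partial i v h -> is_weak_partial i (fun x => u x + v x) (fun x => g x + h x).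
Proof.
move=> Lu Lv /weakP[Lg Hg] /weakP[Lh Hh]; apply/weakP; split; first exact: L2D.
move=> phi tphi; have tdphi := test_partial i tphi.
under eq_Rintegral do rewrite on_ballD mulrDl.
under [in RHS]eq_Rintegral do rewrite on_ballD mulrDl.
by rewrite !intD ?Hg ?Hh ?opprD//; (apply: L1M_test => //; exact: L2_L1).
Qed.

Lemma weak_unique i u g h : is_weak_partial i u g -> is_weak_partial i u h ->
  {ae mu, forall x, on_ball g x = on_ball h x}.
Proof.
move=> /weakP[Lg Hg] /weakP[Lh Hh].
have : {ae mu, forall x, B1 x -> on_ball g x - on_ball h x = 0}.
  apply: test_eq0_ae; first by apply: L1B; exact: L2_L1.
  move=> phi tphi; under eq_Rintegral do rewrite mulrBl.
  rewrite intB; try by apply: L1M_test => //; exact: L2_L1.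
  by apply/eqP; rewrite subr_eq0 -eqr_opp -Hg// -Hh.
apply: filterS => x H; have [x1|x1] := pselect (B1 x).
  by apply/eqP; rewrite -subr_eq0 H.
by rewrite !on_ballNE.
Qed.

Lemma weak_partialP i u : H1 u -> is_weak_partial i u (weak_partial i u).
Proof. by move=> [_ /(_ i)] h; exact: xgetPex. Qed.

Lemma weak_partial_ae i u g : H1 u -> is_weak_partial i u g ->
  {ae mu, forall x, on_ball (weak_partial i u) x = on_ball g x}.
Proof. by move=> Hu; apply: weak_unique; exact: weak_partialP. Qed.

Lemma H1_smooth f : is_Coo f -> H1 f.
Proof.
move=> Cf; split; first exact/L2_continuous/is_Coo_continuous.
by move=> i; exists (partial i f); exact: weak_smooth.
Qed.

Lemma H1D u v : H1 u -> H1 v -> H1 (fun x => u x + v x).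
Proof.
move=> Hu Hv; split; first exact: L2D Hu.1 Hv.1.
move=> i; exists (fun x => weak_partial i u x + weak_partial i v x).
by apply: weakD; [exact: Hu.1|exact: Hv.1|exact: weak_partialP|exact: weak_partialP].
Qed.

Definition dirichlet u : R := \sum_i \int[mu]_x (on_ball (weak_partial i u) x ^+ 2).

(** Built on classical derivatives, so that scaling can be computed exactly instead of through the
    representative chosen by [weak_partial]. *)
Definition dirichlet_smooth f : R := \sum_i \int[mu]_x (on_ball (partial i f) x ^+ 2).

Definition dirichlet_form u f : R :=
  \sum_i \int[mu]_x (on_ball (weak_partial i u) x * partial i f x).

Lemma on_ball_grad_sq u x :
  on_ball (grad_sq u) x = \sum_i on_ball (weak_partial i u) x ^+ 2.
Proof.
have [x1|x1] := pselect (B1 x).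
  by rewrite on_ballE//; apply: eq_bigr => i _; rewrite on_ballE.
by rewrite on_ballNE// big1// => i _; rewrite on_ballNE// expr0n.
Qed.

Lemma L1_weak_partial_sq i u : H1 u -> L1 mu (fun x => on_ball (weak_partial i u) x ^+ 2).
Proof. by move=> /(weak_partialP i)[/L2P[]]. Qed.

Lemma L1_on_ball_grad_sq u : H1 u -> L1 mu (on_ball (grad_sq u)).
Proof.
move=> Hu; rewrite (funext (on_ball_grad_sq u)).
by apply: L1_sum => i; exact: L1_weak_partial_sq.
Qed.

Lemma int_grad_sq u : H1 u -> \int[mu]_(x in B1) grad_sq u x = dirichlet u.
Proof.
move=> Hu; rewrite int_on_ball (funext (on_ball_grad_sq u)) int_sum// => i.
exact: L1_weak_partial_sq.
Qed.

Lemma eint_grad_sq u : H1 u ->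
  (\int[mu]_(x in B1) (grad_sq u x)%:E = (dirichlet u)%:E)%E.
Proof.
move=> Hu; rewrite -int_grad_sq// fineK//; apply: integrable_fin_num.
  exact: measurable_B1.
by apply/L1_on_ball; exact: L1_on_ball_grad_sq.
Qed.

Lemma L1_partial_sq i f : is_Coo f -> L1 mu (fun x => on_ball (partial i f) x ^+ 2).
Proof. by move=> /(weak_smooth i)[/L2P[]]. Qed.

Lemma L1_weak_partialM i u f : H1 u -> is_Coo f ->
  L1 mu (fun x => on_ball (weak_partial i u) x * partial i f x).
Proof.
move=> /(weak_partialP i)[Lu _] /(weak_smooth i)[Lf _].
have := L2M Lu Lf; congr (L1 mu _); apply/funext => x.
have [x1|x1] := pselect (B1 x); first by rewrite !on_ballE.
by rewrite !on_ballNE// !mul0r.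
Qed.

(** The weak derivative of the sum is a fresh choice; by uniqueness it equals the sum of the
    derivatives almost everywhere, which suffices to expand the square under the integral. *)
Lemma dirichlet_add u f : H1 u -> is_Coo f ->
  dirichlet (fun x => u x + f x) =
  dirichlet u + 2 * dirichlet_form u f + dirichlet_smooth f.
Proof.
move=> Hu Cf; rewrite mulr_sumr -!big_split; apply: eq_bigr => i _ /=.
have Huf := H1D Hu (H1_smooth Cf).
have H := weakD Hu.1 (H1_smooth Cf).1 (weak_partialP i Hu) (weak_smooth i Cf).
have ae := weak_partial_ae Huf H.
transitivity (\int[mu]_x ((on_ball (weak_partial i u) x ^+ 2 +
    2 * (on_ball (weak_partial i u) x * partial i f x)) + on_ball (partial i f) x ^+ 2)).
  apply: int_ae.
  - exact: L1_measurable (L1_weak_partial_sq i Huf).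
  - apply: L1_measurable (L1D (L1D (L1_weak_partial_sq i Hu)
      (L1Z 2 (L1_weak_partialM i Hu Cf))) (L1_partial_sq i Cf)).
  - apply: filterS ae => x ->; have [x1|x1] := pselect (B1 x).
      by rewrite !on_ballE//; ring.
    by rewrite !on_ballNE//; ring.
rewrite intD; last exact: L1_partial_sq.
  rewrite intD ?intZ//; [exact: L1_weak_partialM|exact: L1_weak_partial_sq|].
  by apply: L1Z; exact: L1_weak_partialM.
by apply: L1D; [exact: L1_weak_partial_sq|apply: L1Z; exact: L1_weak_partialM].
Qed.

Lemma dirichlet_smoothE f : is_Coo f -> dirichlet f = dirichlet_smooth f.
Proof.
move=> Cf; apply: eq_bigr => i _; apply: int_ae.
- exact: L1_measurable (L1_weak_partial_sq i (H1_smooth Cf)).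
- exact: L1_measurable (L1_partial_sq i Cf).
- by apply: filterS (weak_partial_ae (H1_smooth Cf) (weak_smooth i Cf)) => x ->.
Qed.

Lemma partialD i f g : is_Coo f -> is_Coo g ->
  partial i (fun x => f x + g x) = (fun x => partial i f x + partial i g x).
Proof.
by move=> /(is_Coo_partial i)[hf _] /(is_Coo_partial i)[hg _]; exact/has_partialE/has_partialD.
Qed.

Lemma partialZ i (a : R) f : is_Coo f ->
  partial i (fun x => a * f x) = (fun x => a * partial i f x).
Proof. by move=> /(is_Coo_partial i)[hf _]; exact/has_partialE/has_partialZ. Qed.

Lemma dirichlet_smoothZ (a : R) f : is_Coo f ->
  dirichlet_smooth (fun x => a * f x) = a ^+ 2 * dirichlet_smooth f.
Proof.
move=> Cf; rewrite /dirichlet_smooth mulr_sumr; apply: eq_bigr => i _.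
rewrite partialZ// -intZ; last exact: L1_partial_sq.
by apply: eq_Rintegral => x _; rewrite on_ballZ exprMn.
Qed.

Lemma dirichlet_formZ u (a : R) f : H1 u -> is_Coo f ->
  dirichlet_form u (fun x => a * f x) = a * dirichlet_form u f.
Proof.
move=> Hu Cf; rewrite /dirichlet_form mulr_sumr; apply: eq_bigr => i _.
rewrite partialZ// -intZ; last exact: L1_weak_partialM.
by apply: eq_Rintegral => x _; rewrite mulrCA.
Qed.

Lemma dirichlet_formD u f g : H1 u -> is_Coo f -> is_Coo g ->
  dirichlet_form u (fun x => f x + g x) = dirichlet_form u f + dirichlet_form u g.
Proof.
move=> Hu Cf Cg; rewrite -big_split; apply: eq_bigr => i _ /=.
rewrite partialD// -intD; [|exact: L1_weak_partialM..].
by apply: eq_Rintegral => x _; rewrite mulrDr.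
Qed.

Definition laplacian f x : R := \sum_i partial i (partial i f) x.

(** [partial i phi] is itself a test function, so one use of the weak derivative of [u] in each
    direction is enough. *)
Lemma int_laplacian u phi : H1 u -> test_function phi ->
  \int[mu]_x (on_ball u x * laplacian phi x) = - dirichlet_form u phi.
Proof.
move=> Hu tphi; under eq_Rintegral do rewrite mulr_sumr.
have tdd i : test_function (partial i (partial i phi)) by do 2 apply: test_partial.
rewrite int_sum => [|i]; last by apply: L1M_test => //; exact: L2_L1 Hu.1.
rewrite -sumrN; apply: eq_bigr => i _.
by have /weakP[_ ->] := weak_partialP i Hu; last exact: test_partial.
Qed.

Lemma H1normE f : is_Coo f ->
  H1norm f = Num.sqrt (\int[mu]_x (on_ball f x ^+ 2) + dirichlet_smooth f).
Proof.
move=> Cf; rewrite /H1norm int_grad_sq; last exact: H1_smooth.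
rewrite dirichlet_smoothE// int_on_ball; congr (Num.sqrt (_ + _)).
apply: eq_Rintegral => x _; have [x1|x1] := pselect (B1 x); first by rewrite !on_ballE.
by rewrite !on_ballNE// expr0n.
Qed.

End sobolev.

(** * Competitors *)

Lemma flat_lipschitz (R : realType) (p : {poly R}) :
  exists2 C : R, 0 <= C & forall a b, `|flat p a - flat p b| <= C * `|a - b|.
Proof.
have [C C0 hC] := flat_bounded (flat_diff p); exists C => // a b.
wlog ab : a b / a <= b.
  move=> H; have [/H//|/ltW/H] := leP a b.
  by rewrite distrC (distrC b).
have [c _ e] : exists2 c, c \in `[a, b] &
    flat p b - flat p a = flat (flat_diff p) c * (b - a).
  apply: (MVT_segment (f := flat p) (df := flat (flat_diff p)) ab).
    by move=> x _; exact: is_derive_flat.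
  by apply: continuous_subspaceT; exact: continuous_flat.
by rewrite distrC e normrM (distrC a) ler_wpM2r.
Qed.

(** The first-order condition at a minimum. The range [t <= 1] serves competitors whose positivity
    is known only for small [t]. *)
Lemma linear_coef_ge0 (R : realFieldType) (a b : R) :
  (forall t, 0 < t -> t <= 1 -> 0 <= t * a + t ^+ 2 * b) -> 0 <= a.
Proof.
move=> H; rewrite leNgt; apply/negP => a0.
have d0 : 0 < 2 * (`|b| + 1 - a) by rewrite mulr_gt0// subr_gt0 (lt_trans a0)// ltr_pwDr.
(* This [t] satisfies [t <= 1] and [t |b| < -a/2], so that [a + t b < a/2 < 0]. *)
have t0 : 0 < - a / (2 * (`|b| + 1 - a)) by rewrite divr_gt0// oppr_gt0.
have e : - a / (2 * (`|b| + 1 - a)) * (2 * (`|b| + 1 - a)) = - a.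
  by rewrite divfK// gt_eqF.
move: (- a / _) t0 e => t t0 e.
have b0 := normr_ge0 b.
have t1 : t <= 1 by rewrite -(ler_pM2r d0) e mul1r; lra.
have := H _ t0 t1; have tb : t * b <= t * `|b| by rewrite ler_wpM2l ?ler_norm// ltW.
rewrite expr2 -mulrA -mulrDr pmulr_rge0//.
have ta : t * a < 0 by rewrite pmulr_rlt0.
have e2 : 2 * (t * `|b|) + 2 * t - 2 * (t * a) = - a by rewrite -e; ring.
lra.
Qed.

Section perimeter_and_competitors.
Context {R : realType} {n : nat}.
Local Notation rV := 'rV[R]_n.
Local Notation mu := (@lebesgue_row R n).
Implicit Types (f g h u v phi psi : rV -> R) (i : 'I_n) (x : rV) (Omega : set rV).

Lemma test_cst0 : test_function (cst 0 : rV -> R).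
Proof.
by apply: (@supp_within_test _ _ 0) => [|k|]; [exact: ltr01|exact: is_Ck_cst|].
Qed.

Lemma Per_ge0 Omega : (0 <= Per Omega)%E.
Proof.
apply: ereal_sup_ubound; exists (cst 0).
  split=> [i|]; last first.
    rewrite (_ : (fun _ => _) = cst 0%E) ?Lnorm0// /enorm.
    by apply/funext => x; rewrite big1 ?sqrtr0// => i _; rewrite mxE expr0n.
  have -> : row_coord i \o (cst 0 : rV -> rV) = cst 0.
    by apply/funext => x; rewrite /row_coord /= mxE.
  by split; [exact: is_Ck_cst|exact: test_cst0.2].
rewrite integral0_eq// => x _; rewrite /divergence big1// => i _.
have -> : row_coord i \o (cst 0 : rV -> rV) = cst 0 by apply/funext => y; rewrite /row_coord /= mxE.
by rewrite (has_partialE (has_partial_cst i 0)).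
Qed.

Lemma int_divergence (xi : rV -> rV) : test_field xi ->
  L1 mu (divergence xi) /\ \int[mu]_x divergence xi x = 0.
Proof.
move=> txi.
have H i : L1 mu (partial i (row_coord i \o xi)) /\
    \int[mu]_x partial i (row_coord i \o xi) x = 0.
  have [/is_CkSP[cx /(_ i)[g hg kg]] [cK KB]] := txi i.
  have sx : support_in_cube 1 (row_coord i \o xi).
    move=> x nx; apply/eqP; rewrite -[_ == _]negbK; apply/negP => h.
    by apply: nx; apply: sqn_cube; apply/ltW/B1E/KB/subset_closure.
  rewrite (has_partialE hg); split.
    apply: L1_continuous_support (is_Ck_continuous kg) _.
    exact: support_in_cube_partial hg sx.
  by rewrite /Rintegral (int_partial0 ltr01 hg)//; exact: is_Ck_continuous kg.
split; first by apply: L1_sum => i; have [] := H i.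
by rewrite int_sum => [|i]; [apply: big1 => i _|]; have [] := H i.
Qed.

(** Up to a null set the integral of the divergence runs over the whole space, where it is 0 for
    each admissible field. *)
Lemma Per_full Omega : measurable (Omega `&` B1) ->
  {ae mu, forall x, B1 x -> Omega x} -> (Per Omega <= 0)%E.
Proof.
move=> mO aeO; apply: ge_ereal_sup => _ [xi [txi _] <-].
have [d1 d0] := int_divergence txi; have md := L1_measurable d1.
have out x : ~ B1 x -> divergence xi x = 0.
  move=> nx; rewrite /divergence big1// => i _.
  have [/is_CkSP[cx /(_ i)[g hg kg]] [cK KB]] := txi i.
  rewrite (has_partialE hg).
  have oK : open (~` closure [set x | (row_coord i \o xi) x != 0]).
    exact/closed_openC/closed_closure.
  have h0 : {near x, (cst 0 : rV -> R) =1 (row_coord i \o xi)}.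
    have : nbhs x (~` closure [set x | (row_coord i \o xi) x != 0]).
      by apply: open_nbhs_nbhs; split => // /KB.
    apply: filterS => y yK; apply/esym/eqP; rewrite -[_ == _]negbK; apply/negP => h.
    by apply/yK/subset_closure.
  have := hg x => -[_ <-].
  by rewrite -(near_eq_derive (delta_mx ord0 i) h0); exact: derive_cst.
have -> : (\int[mu]_(x in Omega `&` B1) (divergence xi x)%:E =
   \int[mu]_x (divergence xi x)%:E)%E.
  rewrite integral_mkcond; apply: ae_eq_integral => //.
  - rewrite restrict_EFin; apply/measurable_EFinP; apply: (measurable_restrictT _ mO).1.
    exact: measurable_funTS md.
  - exact/measurable_EFinP.
  - apply: filterS aeO => x Hx _; rewrite patchE; case: ifPn => //.
    rewrite notin_setE => nO; rewrite out// => x1; apply: nO; split => //; exact: Hx.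
by rewrite int_fin// d0.
Qed.

(** The error of replacing [bump 1] by the test function [bump rho]. *)
Definition bump_gap rho x : R := bump 1 x - bump rho x.

Lemma bump_gap_Coo rho : is_Coo (bump_gap rho).
Proof.
apply: is_CooD; first exact: bump_Coo.
by move=> k; apply: is_CkN; exact: bump_Coo.
Qed.

Lemma has_partial_bump rho i : has_partial i (bump rho)
  (fun x => flat (flat_diff 1) (rho - sqn x) * (- (2 * x ord0 i))).
Proof.
apply: has_partial_comp => [s|]; first exact: is_derive_flat.
move=> x; have := has_partialD (has_partial_cst i rho) (has_partialN (has_partial_sqdist i 0)).
move=> /(_ x) h; apply: is_derive_eq h _.
by rewrite /= add0r mxE subr0.
Qed.

(** The gap and its gradient are differences of Lipschitz functions at [1 - sqn x] and
    [rho - sqn x], the gradient with a further factor [|2 x_i| <= 2]. Both are thus of order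
    [1 - rho] uniformly on the ball, which has finite measure. *)
Lemma bump_gap_small : exists2 K : R, 0 <= K & forall rho, rho < 1 ->
  \int[mu]_x (on_ball (bump_gap rho) x ^+ 2) + dirichlet_smooth (bump_gap rho)
  <= K * (1 - rho) ^+ 2.
Proof.
have [C0 C00 h0] := flat_lipschitz (1 : {poly R}).
have [C1 C10 h1] := flat_lipschitz (flat_diff (1 : {poly R})).
have c1 : L1 mu (on_ball (cst 1)) by apply: L1_on_ball_continuous; exact: cst_continuous.
set V := \int[mu]_x on_ball (cst 1) x.
have V0 : 0 <= V by apply: int_ge0 => x; rewrite /on_ball mul1r.
have key f (D : R) : L1 mu (fun x => on_ball f x ^+ 2) -> 0 <= D ->
    (forall x, B1 x -> `|f x| <= D) -> \int[mu]_x (on_ball f x ^+ 2) <= D ^+ 2 * V.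
  move=> f1 D0 fD; rewrite -intZ//; apply: int_le => //; first exact: L1Z.
  move=> x; have [x1|x1] := pselect (B1 x); last by rewrite !on_ballNE// expr0n mulr0.
  rewrite !on_ballE// mulr1 -real_normK ?num_real//.
  by rewrite ler_pXn2r ?nnegrE//; exact: fD.
exists (C0 ^+ 2 * V + \sum_(i < n) (C1 * 2) ^+ 2 * V).
  by rewrite addr_ge0 ?mulr_ge0 ?sqr_ge0//; apply: sumr_ge0 => i _; rewrite mulr_ge0 ?sqr_ge0.
move=> rho r1; have r0 : 0 <= 1 - rho by rewrite subr_ge0 ltW.
rewrite mulrDl mulr_suml; apply: lerD.
  rewrite mulrAC -exprMn; apply: key.
  - by have /L2P[] := L2_continuous (is_Coo_continuous (bump_gap_Coo rho)).
  - exact: mulr_ge0.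
  - move=> x _; apply: le_trans (h0 _ _) _.
    by rewrite opprB addrA subrK ger0_norm.
apply: ler_sum => i _; rewrite mulrAC -exprMn; apply: key.
- exact: L1_partial_sq (bump_gap_Coo rho).
- by rewrite !mulr_ge0.
- move=> x /B1E/ltW/sqn_cube/(_ i); rewrite in_itv/= -ler_norml => xi1.
  have := has_partialD (has_partial_bump 1 i) (has_partialN (has_partial_bump rho i)).
  move/has_partialE => ->; rewrite -mulrBl normrM normrN.
  have := h1 (1 - sqn x) (rho - sqn x); rewrite opprB addrA subrK (ger0_norm r0) => h2.
  rewrite (_ : C1 * 2 * (1 - rho) = C1 * (1 - rho) * 2); last by ring.
  by apply: ler_pM => //; rewrite normrM normr_nat ler_piMr.
Qed.

Lemma H10_bump phi (a : R) : test_function phi ->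
  H10 (fun x => phi x + a * bump 1 x).
Proof.
move=> tphi; have Cf : is_Coo (fun x => phi x + a * bump 1 x).
  by apply: is_CooD; [exact: tphi.1|apply: is_CooZ; exact: bump_Coo].
split; first exact: H1_smooth.
move=> e e0; have [K K0 hK] := bump_gap_small.
(* Chosen to give [a^2 K s^2 < e^2] when [e = s d]; the added ones keep [d] positive if [a] or [K]
   is 0. *)
pose d := 2 * (`|a| + 1) * (K + 1).
have d0 : 0 < d by rewrite !mulr_gt0// ltr_wpDl.
have [s s0 sd] : exists2 s, 0 < s & s * d = e.
  by exists (e / d); rewrite ?divr_gt0// divfK// gt_eqF.
have r1 : 1 - s < 1 by rewrite gtrBl.
exists (fun x => phi x + a * bump (1 - s) x).
  by apply: testD => //; apply: testZ; exact: bump_test.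
rewrite (_ : _ \- _ = fun x => a * bump_gap (1 - s) x); last first.
  by apply/funext => x; rewrite /bump_gap /=; ring.
have Cg := @bump_gap_Coo (1 - s).
rewrite H1normE; last exact: is_CooZ.
rewrite dirichlet_smoothZ// (_ : \int[mu]_x _ =
    a ^+ 2 * \int[mu]_x (on_ball (bump_gap (1 - s)) x ^+ 2)); last first.
  rewrite -intZ; last by have /L2P[] := L2_continuous (is_Coo_continuous Cg).
  by apply: eq_Rintegral => x _; rewrite on_ballZ exprMn.
rewrite -mulrDr -[ltRHS]ger0_norm ?ltW// -sqrtr_sqr ltr_sqrt ?exprn_gt0//.
apply: le_lt_trans (ler_wpM2l (sqr_ge0 a) (hK _ r1)) _.
rewrite opprB addrC subrK -sd /d.
have a2 : a ^+ 2 = `|a| ^+ 2 by rewrite real_normK ?num_real.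
rewrite a2; have := normr_ge0 a; set A := `|a| => A0.
have -> : A ^+ 2 * (K * s ^+ 2) = s ^+ 2 * (A ^+ 2 * K) by ring.
rewrite exprMn ltr_pM2l ?exprn_gt0//.
have -> : (2 * (A + 1) * (K + 1)) ^+ 2 = 4 * ((A + 1) ^+ 2 * (K + 1) ^+ 2) by ring.
have h1 : A ^+ 2 <= (A + 1) ^+ 2 by nra.
have h2 : K <= (K + 1) ^+ 2 by nra.
have h3 : A ^+ 2 * K <= (A + 1) ^+ 2 * (K + 1) ^+ 2 by apply: ler_pM => //; exact: sqr_ge0.
have : 0 < (A + 1) ^+ 2 * (K + 1) ^+ 2 by rewrite mulr_gt0// exprn_gt0// ltr_wpDl.
lra.
Qed.

Lemma minimiser_dirichlet_le u phi (a : R) : minimiser u -> test_function phi ->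
  {ae mu, forall x, B1 x -> 0 < u x + (phi x + a * bump 1 x)} ->
  0 <= 2 * dirichlet_form u (fun x => phi x + a * bump 1 x) +
    dirichlet_smooth (fun x => phi x + a * bump 1 x).
Proof.
move=> [Hu umin] tphi pos; set f := fun x => phi x + a * bump 1 x.
have Cf : is_Coo f.
  by apply: is_CooD; [exact: tphi.1|apply: is_CooZ; exact: bump_Coo].
have Hv := H1D Hu (H1_smooth Cf).
have := umin _ Hv; rewrite (_ : u \- _ = fun x => (-1) * phi x + (- a) * bump 1 x); last first.
  by apply/funext => x; rewrite /f /=; ring.
move=> /(_ (H10_bump (- a) (testZ (-1) tphi))).
rewrite /energy !eint_grad_sq// dirichlet_add// => Eu.
have mO : measurable ([set x | 0 < u x + f x] `&` B1).
  have [[mv _] _] := Hv; have := mv (@measurable_B1 R n) _ (measurable_itv `]0, +oo[).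
  by rewrite setIC; congr measurable; apply/seteqP; split => x /= -[];
    rewrite in_itv/= andbT.
have P0 := Per_full mO pos.
have : ((dirichlet u)%:E <= (dirichlet u + 2 * dirichlet_form u f + dirichlet_smooth f)%:E)%E.
  apply: le_trans (leeDl _ (Per_ge0 [set x | 0 < u x])) _; apply: le_trans Eu _.
  by rewrite -[leRHS]adde0; apply: leeD.
by rewrite lee_fin; lra.
Qed.

(** Where both [u] and [phi] vanish, only the term with [bump 1] makes the competitor positive. The
    first-order condition is taken for fixed [e], and [e] is sent to 0 afterwards. *)
Lemma minimiser_superharmonic u phi : minimiser u ->
  {ae mu, forall x, B1 x -> 0 <= u x} -> test_function phi ->
  (forall x, 0 <= phi x) -> 0 <= dirichlet_form u phi.
Proof.
move=> umin u0 tphi phi0; have Hu := umin.1.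
have Cphi := tphi.1; have Cb := @bump_Coo R n 1.
have H (e : R) : 0 < e -> 0 <= dirichlet_form u (fun x => phi x + e * bump 1 x).
  move=> e0; set z := fun x => _; have Cz : is_Coo z.
    by apply: is_CooD => //; exact: is_CooZ.
  rewrite -(@pmulr_rge0 _ 2)//; apply: (@linear_coef_ge0 _ _ (dirichlet_smooth z)) => t t0 _.
  have := @minimiser_dirichlet_le u (fun x => t * phi x) (t * e) umin (testZ t tphi).
  rewrite (_ : (fun x => t * phi x + t * e * bump 1 x) = fun x => t * z x); last first.
    by apply/funext => x; rewrite /z; ring.
  rewrite dirichlet_formZ// dirichlet_smoothZ// mulrCA; apply.
  apply: filterS u0 => x Hx x1; rewrite ltr_wpDl ?Hx// ltr_wpDl ?mulr_ge0// ?ltW//.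
  by rewrite mulr_gt0 ?mulr_gt0// bump_gt0//; exact/B1E.
apply: (@linear_coef_ge0 _ _ 0) => t t0 _; rewrite mulr0 addr0.
apply: mulr_ge0; first exact: ltW.
apply/ler_addgt0Pr => e e0.
(* The weight of [bump 1] is chosen so that its contribution to the form is at most [e]. *)
have b1 : 0 < `|dirichlet_form u (bump 1)| + 1 by rewrite ltr_pwDr.
have s0 : 0 < e / (`|dirichlet_form u (bump 1)| + 1) by rewrite divr_gt0.
have := H _ s0; rewrite dirichlet_formD//; last exact: is_CooZ.
rewrite dirichlet_formZ//; set s := e / _ => h.
have e1 : s * (`|dirichlet_form u (bump 1)| + 1) = e by rewrite /s divfK// gt_eqF.
apply: le_trans h _; rewrite lerD2l -e1 ler_wpM2l//; first exact: ltW.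
by apply: le_trans (ler_norm _) _; rewrite lerDl.
Qed.

End perimeter_and_competitors.

(** * Radial averages *)

Section radial_kernel.
Context {R : realType} {n : nat}.
Local Notation rV := 'rV[R]_n.
Local Notation mu := (@lebesgue_row R n).
Local Notation P1 := (flat_diff (1 : {poly R})).
Local Notation P2 := (flat_diff P1).
Implicit Types (f h u phi : rV -> R) (i : 'I_n) (x y : rV) (l : R).

(* [l] is the inverse of the radius of the kernel. *)
Definition kernel_profile l x y : R := 1 - l ^+ 2 * sqdist x y.

(** The profile [flat P1] is the derivative of [flat 1], which is what turns the derivative in [l]
    into a Laplacian. The power of [l] makes the total mass independent of the scale; it is not
    normalised to 1. *)
Definition kernel l x y : R := l ^+ n * flat P1 (kernel_profile l x y).

Definition kernel_deriv l x y : R :=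
  n%:R * l ^+ n.-1 * flat P1 (kernel_profile l x y) -
  l ^+ n * (flat P2 (kernel_profile l x y) * (2 * l * sqdist x y)).

(** Nonnegative and, for [l > 0], supported in the closed ball of radius [1/l] around [x]: the test
    function behind the monotonicity of averages. *)
Definition kernel_potential l x y : R := flat 1 (kernel_profile l x y).

Definition average h l x : R := \int[mu]_y (h y * kernel l x y).

Lemma flat_P1_ge0 (s : R) : 0 <= flat P1 s.
Proof.
rewrite /flat; case: ifP => // s0.
by rewrite /flat_diff derivC subr0 mulr1 hornerXn mulr_ge0 ?sqr_ge0 ?expR_ge0.
Qed.

Lemma flat_P1_gt0 (s : R) : 0 < s -> 0 < flat P1 s.
Proof.
move=> s0; rewrite /flat s0.
by rewrite /flat_diff derivC subr0 mulr1 hornerXn mulr_gt0 ?expR_gt0// exprn_gt0// invr_gt0.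
Qed.

Lemma kernelC l x y : kernel l x y = kernel l y x.
Proof. by rewrite /kernel /kernel_profile sqdistC. Qed.

Lemma kernel_ge0 l x y : 0 <= l -> 0 <= kernel l x y.
Proof. by move=> l0; rewrite mulr_ge0 ?exprn_ge0// flat_P1_ge0. Qed.

Lemma kernel_gt0 l x y : 0 < l -> l ^+ 2 * sqdist x y < 1 -> 0 < kernel l x y.
Proof.
by move=> l0 h; rewrite mulr_gt0 ?exprn_gt0// flat_P1_gt0// /kernel_profile subr_gt0.
Qed.

Lemma kernel_out l x y : 1 <= l ^+ 2 * sqdist x y -> kernel l x y = 0.
Proof. by move=> h; rewrite /kernel flat_le0 ?mulr0// subr_le0. Qed.

Lemma kernel_bounded : exists2 C : R, 0 <= C & forall l x y, 0 <= l ->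
  `|kernel l x y| <= l ^+ n * C.
Proof.
have [C C0 hC] := flat_bounded P1; exists C => // l x y l0.
by rewrite normrM ger0_norm ?exprn_ge0// ler_wpM2l ?exprn_ge0.
Qed.

Lemma continuous_kernel_profile l x : continuous (kernel_profile l x).
Proof.
apply: (@is_Ck_continuous _ _ 0); apply: is_CkD; first exact: is_Ck_cst.
by apply: is_CkN; apply: is_CkZ; exact: is_Ck_sqdist.
Qed.

Lemma measurable_flat_profile p l x :
  measurable_fun setT (fun y => flat p (kernel_profile l x y)).
Proof.
apply: continuous_measurable_row => y.
apply: continuous_comp; first exact: continuous_kernel_profile.
exact: continuous_flat.
Qed.

Lemma measurable_kernel l x : measurable_fun setT (kernel l x).
Proof. by apply: measurable_funM => //; exact: measurable_flat_profile. Qed.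

Lemma L1_kernel h l x : 0 <= l -> L1 mu h -> L1 mu (fun y => h y * kernel l x y).
Proof.
move=> l0 h1; have [C C0 hC] := kernel_bounded.
by apply: (L1M_bounded (C := l ^+ n * C) h1) => [|y]; [exact: measurable_kernel|exact: hC].
Qed.

Lemma is_derive_exprn m (l : R) : is_derive l 1 (fun l : R => l ^+ m) (m%:R * l ^+ m.-1).
Proof.
apply: DeriveDef; first exact: exprn_derivable.
by rewrite exp_derive [LHS]mulr1.
Qed.

Lemma is_derive_kernel x y l :
  is_derive l 1 (fun l => kernel l x y) (kernel_deriv l x y).
Proof.
have hs : is_derive l 1 (fun l => kernel_profile l x y) (- (2 * l * sqdist x y)).
  have h1 := is_deriveM (is_derive_exprn 2 l) (is_derive_cst (sqdist x y) l (1 : R)).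
  have h2 := is_deriveB (is_derive_cst (1 : R) l (1 : R)) h1.
  apply: is_derive_eq h2 _ => /=.
  by rewrite sub0r scaler0 add0r expr1 [_ *: _]mulrC.
have h3 := @is_derive1_comp _ (flat P1) (fun l => kernel_profile l x y) _ _ _
    (is_derive_flat P1 (kernel_profile l x y)) hs.
have h4 := is_deriveM (is_derive_exprn n l) h3.
apply: is_derive_eq h4 _; rewrite /kernel_deriv /= !/(_ *: _) /=.
ring.
Qed.

(** [sqdist x y] is unbounded, but where [flat P2] does not vanish it is at most [a^-2]. Uniformity
    in [l] is what differentiation under the integral asks for. *)
Lemma kernel_deriv_bounded (a b : R) : 0 < a -> exists2 C : R, 0 <= C &
  forall l x y, a < l -> l < b -> `|kernel_deriv l x y| <= C.
Proof.
move=> a0; have [C1 C10 h1] := flat_bounded P1; have [C2 C20 h2] := flat_bounded P2.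
exists (n%:R * `|b| ^+ n.-1 * C1 + `|b| ^+ n * (C2 * (2 * `|b| * a ^- 2))).
  by rewrite addr_ge0 ?mulr_ge0 ?exprn_ge0// invr_ge0 exprn_ge0// ltW.
move=> l x y al lb; have l0 : 0 < l by exact: lt_trans al.
have lb' : l <= `|b| by rewrite (le_trans (ltW lb))// ler_norm.
apply: le_trans (ler_normB _ _) _; apply: lerD.
  rewrite !normrM normr_nat normrX (gtr0_norm l0).
  apply: ler_pM => //; first by rewrite mulr_ge0 ?exprn_ge0// ltW.
  by rewrite ler_wpM2l// lerXn2r// nnegrE ltW.
rewrite !normrM normrX (gtr0_norm l0) normr_nat (ger0_norm (sqdist_ge0 _ _)).
have [s0|s0] := ltP 0 (kernel_profile l x y); last first.
  rewrite flat_le0// normr0 mul0r mulr0 mulr_ge0 ?exprn_ge0// mulr_ge0// mulr_ge0 ?mulr_ge0//.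
  by rewrite invr_ge0 exprn_ge0// ltW.
have q1 : sqdist x y <= a ^- 2.
  move: s0; rewrite subr_gt0 => /ltW q1.
  rewrite -[leRHS]mul1r ler_pdivlMr ?exprn_gt0// mulrC; apply: le_trans q1.
  by rewrite ler_wpM2r ?sqdist_ge0// lerXn2r// ?nnegrE ltW.
apply: ler_pM => //; rewrite ?mulr_ge0 ?exprn_ge0 ?sqdist_ge0//; try exact: ltW.
  by rewrite lerXn2r// nnegrE ltW.
apply: ler_pM => //; rewrite ?mulr_ge0 ?sqdist_ge0//; try exact: ltW.
apply: ler_pM => //; rewrite ?mulr_ge0 ?sqdist_ge0//; try exact: ltW.
by rewrite ler_wpM2l.
Qed.

Lemma is_derive_average h x l : 0 < l -> L1 mu h ->
  is_derive l 1 (fun l => average h l x) (\int[mu]_y (h y * kernel_deriv l x y)).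
Proof.
(* An interval around [l] that stays away from 0. *)
move=> l0 h1; pose a := l / 2; pose b := l + 1.
have a0 : 0 < a by rewrite divr_gt0.
have [C C0 hC] := @kernel_deriv_bounded a b a0.
have pE l' y : partial1of2 (fun l y => h y * kernel l x y) l' y = h y * kernel_deriv l' x y.
  rewrite partial1of2E.
  have d := is_deriveM (is_derive_cst (h y) l' (1 : R)) (is_derive_kernel x y l').
  by rewrite (derive_val (is_derive := d)) scaler0 addr0.
have Ia : `]a, b[%classic l by rewrite /= in_itv/= /a /b; apply/andP; split; lra.
have H1 : forall l', `]a, b[%classic l' ->
    mu.-integrable setT (EFin \o (fun y => h y * kernel l' x y)).
  move=> l'; rewrite /= in_itv/= => /andP[al' _].
  by apply: L1_kernel => //; apply: ltW; exact: lt_trans al'.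
have H2 : forall l' y, `]a, b[%classic l' -> setT y ->
    derivable (fun l => h y * kernel l x y) l' 1.
  by move=> l' y _ _; apply: derivableM => //; have [] := is_derive_kernel x y l'.
have H3 : forall l' y, `]a, b[%classic l' -> setT y ->
    `|partial1of2 (fun l y => h y * kernel l x y) l' y| <= C * `|h y|.
  move=> l' y; rewrite /= in_itv/= => /andP[al' l'b] _.
  by rewrite pE normrM mulrC ler_wpM2r// hC.
have G0 y : 0 <= C * `|h y| by rewrite mulr_ge0.
have G1 : mu.-integrable setT (EFin \o (fun y => C * `|h y|)) by apply: L1Z; exact: L1_norm.
have D1 := derivable_under_integral measurableT Ia H1 H2 G0 G1 H3.
have D2 := differentiation_under_integral measurableT Ia H1 H2 G0 G1 H3.
apply: DeriveDef; first exact: D1.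
rewrite -derive1E D2; apply: eq_Rintegral => y _; exact: pE.
Qed.

Lemma is_Coo_potential l x : is_Coo (kernel_potential l x).
Proof.
move=> k; apply: is_Ck_flat; apply: is_CkD; first exact: is_Ck_cst.
by apply: is_CkN; apply: is_CkZ; exact: is_Ck_sqdist.
Qed.

Lemma laplacian_potential l x y : laplacian (kernel_potential l x) y =
  l ^+ 4 * 4 * sqdist x y * flat P2 (kernel_profile l x y) -
  n%:R * (2 * l ^+ 2) * flat P1 (kernel_profile l x y).
Proof.
have hs i : has_partial i (kernel_profile l x)
    (fun y => - (l ^+ 2 * (2 * (y ord0 i - x ord0 i)))).
  have h := has_partialD (has_partial_cst i 1)
    (has_partialN (has_partialZ (l ^+ 2) (has_partial_sqdist i x))).
  by move=> z; apply: is_derive_eq (h z) _; rewrite /= add0r.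
have hG i : has_partial i (kernel_potential l x)
    (fun y => flat P1 (kernel_profile l x y) * - (l ^+ 2 * (2 * (y ord0 i - x ord0 i)))).
  by apply: has_partial_comp => // s; exact: is_derive_flat.
have hl i : has_partial i (fun y => - (l ^+ 2 * (2 * (y ord0 i - x ord0 i))))
    (cst (- (l ^+ 2 * 2))).
  have h := has_partialN (has_partialZ (l ^+ 2) (has_partialZ 2
    (has_partialD (has_partial_coord i i) (has_partial_cst i (- x ord0 i))))).
  by move=> z; apply: is_derive_eq (h z) _; rewrite /= eqxx addr0 mulr1.
have hf i : has_partial i (fun y => flat P1 (kernel_profile l x y))
    (fun y => flat P2 (kernel_profile l x y) * - (l ^+ 2 * (2 * (y ord0 i - x ord0 i)))).
  by apply: has_partial_comp => // s; exact: is_derive_flat.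
rewrite /laplacian.
transitivity (\sum_i (l ^+ 4 * 4 * flat P2 (kernel_profile l x y) * (y ord0 i - x ord0 i) ^+ 2 -
   (2 * l ^+ 2) * flat P1 (kernel_profile l x y))).
  apply: eq_bigr => i _.
  rewrite (has_partialE (hG i)) (has_partialE (has_partialM (hf i) (hl i))) /=; ring.
rewrite sumrB -mulr_sumr -/(sqdist x y) sumr_const card_ord -mulr_natl; ring.
Qed.

(* [kernel_deriv] is the derivative of the kernel in [l]: with [r = l^-1] this is
   d/dr (r^-n psi'(1-|z|^2/r^2)) = (1/2) r^(1-n) Delta (psi(1-|z|^2/r^2)). *)
Lemma kernel_deriv_laplacian l x y :
  l ^+ 3 * kernel_deriv l x y =
  - (l ^+ n / 2) * laplacian (kernel_potential l x) y.
Proof.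
rewrite laplacian_potential /kernel_deriv.
(* True for [n = 0] as well, where the factor [n%:R] makes up for the truncated [n.-1]. *)
have e : n%:R * l ^+ n.-1 * l = n%:R * l ^+ n.
  by case: (n) => [|m]; rewrite ?mul0r// -mulrA -exprSr.
rewrite mulrBr; set a := flat P1 _; set b := flat P2 _; set q := sqdist x y.
rewrite (_ : l ^+ 3 * (n%:R * l ^+ n.-1 * a) = (n%:R * l ^+ n.-1 * l) * l ^+ 2 * a); last by ring.
by rewrite e; field.
Qed.

(** The mean value theorem in the scale combined with [kernel_deriv_laplacian]. The factor [c ^+ 3]
    avoids a division and leaves the sign visible: averages grow with [l] when the integral against
    the Laplacian is nonpositive. *)
Lemma average_MVT h x (a b : R) : 0 < a -> a <= b -> L1 mu h ->
  exists2 c, a <= c <= b & c ^+ 3 * (average h b x - average h a x) =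
    - (c ^+ n / 2) * (\int[mu]_y (h y * laplacian (kernel_potential c x) y)) * (b - a).
Proof.
move=> a0 ab h1.
have hd c : c \in `[a, b] -> is_derive c 1 (fun l => average h l x)
    (\int[mu]_y (h y * kernel_deriv c x y)).
  rewrite in_itv/= => /andP[ac _]; apply: is_derive_average => //; exact: lt_le_trans ac.
have hdo c : c \in `]a, b[ -> is_derive c 1 (fun l => average h l x)
    (\int[mu]_y (h y * kernel_deriv c x y)).
  by move=> cab; apply: hd; exact: subset_itv_oo_cc cab.
have hc : {within `[a, b], continuous (fun l => average h l x)}.
  apply: (@derivable_within_continuous R R^o (fun l => average h l x) `[a, b]) => c cab.
  by case: (hd c cab) => d _; exact: d.
have [c cab e] := MVT_segment ab hdo hc.
have c0 : 0 < c by move: cab; rewrite in_itv/= => /andP[ac _]; exact: lt_le_trans ac.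
exists c; first by move: cab; rewrite in_itv.
rewrite e mulrA; congr (_ * _).
have kd1 : L1 mu (fun y => h y * kernel_deriv c x y).
  have c20 : 0 < c / 2 by rewrite divr_gt0.
  have [C C0 hC] := @kernel_deriv_bounded (c / 2) (c + 1) c20.
  apply: (L1M_bounded (C := C) h1); last first.
    by move=> y; apply: hC; lra.
  have mq : measurable_fun setT (sqdist x).
    by apply: continuous_measurable_row; exact: is_Ck_continuous (is_Ck_sqdist 0 x).
  apply: measurable_funB.
    by apply: measurable_funM => //; exact: measurable_flat_profile.
  apply: measurable_funM => //; apply: measurable_funM; first exact: measurable_flat_profile.
  exact: measurable_funM.
rewrite -intZ//; under eq_Rintegral do rewrite mulrCA kernel_deriv_laplacian mulrCA.
rewrite intZ//.
rewrite (_ : (fun y => _) = (fun y => (- (c ^+ n / 2))^-1 * (c ^+ 3 * (h y * kernel_deriv c x y)))).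
  by apply: L1Z; exact: L1Z.
apply/funext => y; rewrite [c ^+ 3 * _]mulrCA kernel_deriv_laplacian [h y * (_ * _)]mulrCA mulKf//.
by rewrite oppr_eq0 mulf_neq0// ?invr_eq0 ?expf_neq0// gt_eqF.
Qed.

End radial_kernel.

(** * Bounds, continuity and symmetry of averages *)

Section averages.
Context {R : realType} {n : nat}.
Local Notation rV := 'rV[R]_n.
Local Notation mu := (@lebesgue_row R n).
Local Notation P1 := (flat_diff (1 : {poly R})).
Implicit Types (f h u phi : rV -> R) (i : 'I_n) (x y c : rV) (l a d : R).

(** The triangle inequality without roots; Cauchy-Schwarz enters as the nonnegativity of the sum of
    the [(d p_i - a q_i)^2]. *)
Lemma sqdist_triangle c x y a d : 0 < a -> 0 < d ->
  sqdist c x <= a ^+ 2 -> sqdist x y <= d ^+ 2 -> sqdist c y <= (a + d) ^+ 2.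
Proof.
move=> a0 d0 cx xy.
pose p i := x ord0 i - c ord0 i; pose q i := y ord0 i - x ord0 i.
have e : sqdist c y = sqdist c x + 2 * (\sum_i p i * q i) + sqdist x y.
  rewrite mulr_sumr -!big_split; apply: eq_bigr => i _ /=; rewrite /p /q; ring.
have h : 0 <= d ^+ 2 * sqdist c x - 2 * (a * d) * (\sum_i p i * q i) + a ^+ 2 * sqdist x y.
  rewrite !mulr_sumr -sumrN -!big_split; apply: sumr_ge0 => i _ /=.
  rewrite (_ : _ + _ = (d * p i - a * q i) ^+ 2) ?sqr_ge0//.
  by rewrite /p /q; ring.
have ad0 : 0 < a * d by rewrite mulr_gt0.
have S : \sum_i p i * q i <= a * d.
  rewrite -(ler_pM2l ad0).
  have h1 : d ^+ 2 * sqdist c x <= d ^+ 2 * a ^+ 2 by rewrite ler_wpM2l ?sqr_ge0.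
  have h2 : a ^+ 2 * sqdist x y <= a ^+ 2 * d ^+ 2 by rewrite ler_wpM2l ?sqr_ge0.
  have e1 : a * d * (a * d) = d ^+ 2 * a ^+ 2 by ring.
  have e2 : a ^+ 2 * d ^+ 2 = d ^+ 2 * a ^+ 2 by ring.
  rewrite e1; rewrite e2 in h2; move: h; rewrite -(mulrA 2); lra.
by rewrite e sqrrD mulr_natl -(mulr_natl (a * d)); lra.
Qed.

Lemma average_bound h : L1 mu h -> exists2 C : R, 0 <= C &
  forall l x, 0 <= l -> `|average h l x| <= l ^+ n * C.
Proof.
move=> h1; have [C C0 hC] := @kernel_bounded R n.
exists (C * \int[mu]_y `|h y|); first by rewrite mulr_ge0// int_ge0.
move=> l x l0; rewrite mulrA -intZ; last exact: L1_norm.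
apply: int_norm_le; first exact: L1_kernel.
  by apply: L1Z; exact: L1_norm.
by move=> y; rewrite normrM mulrC ler_wpM2r// hC.
Qed.

Lemma continuous_average h l (L : R) : 0 <= L -> 0 <= l -> L1 mu h -> support_in_cube L h ->
  continuous (average h l).
Proof.
move=> L0 l0 h1 sh x; have [C C0 hC] := flat_lipschitz P1.
pose I0 := \int[mu]_y `|h y|; have I00 : 0 <= I0 by apply: int_ge0.
(* [sqdist x y - sqdist z y] is the sum of [(z_i - x_i)(2 y_i - x_i - z_i)]; with [|y_i| <= L] and
   [|z_i - x_i| <= 1] the second factors are bounded by the terms of [S]. *)
pose S := \sum_i (2 * L + 2 * `|x ord0 i| + 1).
have S0 : 0 <= S by apply: sumr_ge0 => i _; rewrite !addr_ge0 ?mulr_ge0.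
pose K := l ^+ n * (C * (l ^+ 2 * S)) * I0 + 1.
have K0 : 0 < K by rewrite ltr_wpDl// !mulr_ge0 ?exprn_ge0.
apply/(@cvgrPdist_le _ _ _ (nbhs x)) => e e0.
apply/near_rowP; exists (Num.min 1 (e / K)); first by rewrite lt_min ltr01 divr_gt0.
move=> z hz; set dl := Num.min 1 (e / K) in hz.
have dl0 : 0 < dl by rewrite lt_min ltr01 divr_gt0.
have dl1 : dl <= 1 by rewrite ge_min lexx.
rewrite /average -intB; [|exact: L1_kernel..].
have sqd y : cube L y -> `|sqdist x y - sqdist z y| <= dl * S.
  move=> cy; rewrite /sqdist -sumrB mulr_sumr.
  apply: le_trans (ler_norm_sum _ _ _) _; apply: ler_sum => i _.
  rewrite (_ : _ - _ = (z ord0 i - x ord0 i) *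
      (2 * y ord0 i - 2 * x ord0 i - (z ord0 i - x ord0 i))); last by ring.
  rewrite normrM; apply: ler_pM => //; first exact/ltW/hz.
  apply: le_trans (ler_normB _ _) _; apply: lerD; last by rewrite (le_trans (ltW (hz i))).
  apply: le_trans (ler_normB _ _) _; rewrite !normrM normr_nat lerD2r ler_wpM2l//.
  by rewrite ler_norml; have := cy i; rewrite in_itv.
apply: (@le_trans _ _ (\int[mu]_y ((l ^+ n * (C * (l ^+ 2 * (dl * S)))) * `|h y|))).
  apply: int_norm_le.
  - by apply: L1B; exact: L1_kernel.
  - by apply: L1Z; exact: L1_norm.
  - move=> y; have [cy|cy] := pselect (cube L y); last by rewrite sh// !mul0r subrr normr0 mulr0.
    rewrite -mulrBr normrM mulrC ler_wpM2r// /kernel -mulrBr normrM ger0_norm ?exprn_ge0//.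
    rewrite ler_wpM2l ?exprn_ge0//; apply: le_trans (hC _ _) _; rewrite ler_wpM2l//.
    rewrite /kernel_profile (_ : _ - _ = l ^+ 2 * (sqdist z y - sqdist x y)); last by ring.
    rewrite normrM distrC.
    by rewrite ger0_norm ?exprn_ge0// ler_wpM2l ?exprn_ge0// sqd.
rewrite intZ; last exact: L1_norm.
rewrite -/I0 (_ : _ * I0 = dl * (l ^+ n * (C * (l ^+ 2 * S)) * I0)); last by ring.
have : dl <= e / K by rewrite ge_min lexx orbT.
rewrite ler_pdivlMr// => h2; apply: le_trans h2; rewrite ler_wpM2l ?(ltW dl0)//.
by rewrite lerDl.
Qed.

(** Fubini and the symmetry of the kernel; a bounded kernel makes the double integrand
    integrable. *)
Lemma int_average_swap phi h l : 0 <= l -> L1 mu phi -> L1 mu h ->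
  \int[mu]_x (phi x * average h l x) = \int[mu]_y (h y * average phi l y).
Proof.
move=> l0 p1 h1.
have [C C0 hC] := @kernel_bounded R n.
have mp := L1_measurable p1; have mh := L1_measurable h1.
pose F (z : rV * rV) : \bar R := (phi z.1 * (h z.2 * kernel l z.1 z.2))%:E.
have mk : measurable_fun setT (fun z : rV * rV => kernel l z.1 z.2).
  apply: measurable_funM => //.
  apply: (measurableT_comp (f := flat P1)).
    by apply: continuous_measurable_fun; exact: continuous_flat.
  apply: measurable_funB => //; apply: measurable_funM => //.
  rewrite (_ : (fun z => _) = fun z => \sum_i (row_coord i z.2 - row_coord i z.1) ^+ 2)//.
  apply: measurable_sum => i; apply: measurable_funX; apply: measurable_funB.
    exact: measurableT_comp (measurable_row_coord i) measurable_snd.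
  exact: measurableT_comp (measurable_row_coord i) measurable_fst.
have mF : measurable_fun setT F.
  apply/measurable_EFinP; apply: measurable_funM.
    exact: measurableT_comp mp measurable_fst.
  by apply: measurable_funM => //; exact: measurableT_comp mh measurable_snd.
have iF : ((mu : {measure set _ -> \bar R}) \x mu)%E.-integrable setT F.
  apply/integrable12ltyP => //.
  apply: (@le_lt_trans _ _ (\int[mu]_x ((l ^+ n * C * \int[mu]_y `|h y|) * `|phi x|)%:E)%E).
    apply: ge0_le_integral => //.
    - by move=> x _; apply: integral_ge0.
    - apply: (@measurable_fun_fubini_tonelli_F _ _ _ _ _ mu (abse \o F)) => [|z].
        exact: measurableT_comp.
      exact: abse_ge0.
    - by apply/measurable_EFinP; apply: measurable_funM => //; exact: measurableT_comp.
    - move=> x _; rewrite /F /=.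
      have k1 : L1 mu (fun y => phi x * (h y * kernel l x y)) by apply: L1Z; exact: L1_kernel.
      rewrite (_ : \int[mu]_y _ = (\int[mu]_y `|phi x * (h y * kernel l x y)|)%:E)%E; last first.
        exact: int_fin (L1_norm k1).
      rewrite lee_fin mulrAC -intZ; last exact: L1_norm.
      apply: int_le; first exact: L1_norm.
        by apply: L1Z; exact: L1_norm.
      move=> y; rewrite (normrM (phi x)) (normrM (h y)) mulrA.
      rewrite [leRHS](_ : _ = (`|phi x| * `|h y|) * (l ^+ n * C)); last by ring.
      by rewrite ler_wpM2l ?mulr_ge0// hC.
  have := int_fin (L1Z (l ^+ n * C * \int[mu]_y `|h y|) (L1_norm p1)).
  by move=> ->; exact: ltry.
have := Fubini iF; rewrite /F /= => fub.
rewrite /Rintegral; congr fine.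
transitivity (\int[mu]_x \int[mu]_y (phi x * (h y * kernel l x y))%:E)%E.
  apply: eq_integral => x _.
  have k1 : L1 mu (fun y => h y * kernel l x y) by exact: L1_kernel.
  by rewrite (int_fin (L1Z (phi x) k1)) intZ.
rewrite fub; apply: eq_integral => y _.
have k1 : L1 mu (fun x => phi x * kernel l y x) by exact: L1_kernel.
rewrite (_ : (fun x => (phi x * (h y * kernel l x y))%:E) =
    (fun x => (h y * (phi x * kernel l y x))%:E)).
  by rewrite (int_fin (L1Z (h y) k1)) intZ.
by apply/funext => x; rewrite (kernelC l x y) mulrCA.
Qed.

End averages.

(** * Monotonicity of averages and the mass of the kernel *)

Section mean_value.
Context {R : realType} {n : nat}.
Local Notation rV := 'rV[R]_n.
Local Notation mu := (@lebesgue_row R n).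
Local Notation P1 := (flat_diff (1 : {poly R})).
Implicit Types (f h u phi : rV -> R) (i : 'I_n) (x y c : rV) (l a d : R).

(** The distributional form, with all derivatives on the test function, so that potentials can be
    inserted directly. *)
Definition superharmonic u := L1 mu (on_ball u) /\
  forall phi, test_function phi -> (forall x, 0 <= phi x) ->
    \int[mu]_x (on_ball u x * laplacian phi x) <= 0.

Lemma potential_out l x y : 1 <= l ^+ 2 * sqdist x y -> kernel_potential l x y = 0.
Proof. by move=> h; rewrite /kernel_potential flat_le0// subr_le0. Qed.

(** [a] bounds the norm of [x], so the support lies in the ball of radius [a + l^-1] around the
    origin. *)
Lemma potential_test a l x : 0 < a -> 0 < l -> a + l^-1 < 1 -> sqn x <= a ^+ 2 ->
  test_function (kernel_potential l x).
Proof.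
move=> a0 l0 al xa; have li0 : 0 < l^-1 by rewrite invr_gt0.
apply: (@supp_within_test _ _ ((a + l^-1) ^+ 2)); last first.
- move=> y hy; apply: potential_out; rewrite leNgt; apply/negP => h.
  have : sqdist x y <= l^-1 ^+ 2.
    by rewrite exprVn -[leRHS]mul1r ler_pdivlMr ?exprn_gt0// mulrC ltW.
  by move=> /(sqdist_triangle a0 li0 xa); rewrite leNgt hy.
- exact: is_Coo_potential.
- by rewrite expr_lt1// ltW// addr_gt0.
Qed.

(** At the intermediate scale the potential is a nonnegative test function, so the increment has the
    sign required. The largest radius [l1^-1] is the only one whose fit in the ball has to be
    assumed. *)
Lemma average_superharmonic u a l1 l2 x : superharmonic u -> 0 < a -> 0 < l1 ->
  l1 <= l2 -> a + l1^-1 < 1 -> sqn x <= a ^+ 2 ->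
  average (on_ball u) l1 x <= average (on_ball u) l2 x.
Proof.
move=> [u1 hu] a0 l10 l12 al xa.
have [c /andP[lc cl] e] := average_MVT x l10 l12 u1.
have c0 : 0 < c by exact: lt_le_trans lc.
rewrite -subr_ge0 -(pmulr_rge0 _ (exprn_gt0 3 c0)) e mulr_ge0 ?subr_ge0//.
rewrite mulNr -mulrN mulr_ge0//; first by rewrite divr_ge0// exprn_ge0// ltW.
rewrite oppr_ge0; apply: hu; last by move=> y; exact: flat1_ge0.
apply: (potential_test a0 c0 _ xa); apply: le_lt_trans al.
by rewrite lerD2l lef_pV2// posrE.
Qed.

(* [cube 3] contains the support of every [kernel l x] with [1 <= l] and [x] in the
   ball, so its indicator plays the role of the constant 1.  Dividing by [mass]
   instead of normalizing the kernel avoids any appeal to the invariance of the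
   measure under translations and dilations. *)
Definition unit_density : rV -> R := \1_(cube 3).

Definition mass x : R := average unit_density 1 x.

Lemma unit_density_L1 : L1 mu unit_density.
Proof. exact: L1_indic_cube. Qed.

Lemma unit_density_support : support_in_cube 3 unit_density.
Proof. by move=> x nx; rewrite /unit_density indicE memNset. Qed.

Lemma sqdist_cube x y : cube 1 x -> sqdist x y <= 1 -> cube 2 y.
Proof.
move=> cx xy i; have := le_trans (coord_le_sqdist x y i) xy.
by have := cx i; rewrite !in_itv/= => /andP[? ?] h; apply/andP; split; nra.
Qed.

Lemma B1_cube x : B1 x -> cube 1 x.
Proof. by move=> /B1E/ltW/sqn_cube. Qed.

Lemma cube_le (L L' : R) x : L <= L' -> cube L x -> cube L' x.
Proof.
by move=> LL' cx i; have := cx i; rewrite !in_itv/= => /andP[? ?]; apply/andP; split; lra.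
Qed.

(** The density is 1 on the support of the potential, whose Laplacian integrates to 0; hence the
    increment in [average_MVT] is 0. The support may leave the unit ball, so integration by parts is
    done in [cube 2]. *)
Lemma mass_scale l x : B1 x -> 1 <= l -> average unit_density l x = mass x.
Proof.
move=> /B1_cube cx l1.
have [c /andP[lc cl] e] := average_MVT x ltr01 l1 unit_density_L1.
have c0 : 0 < c by exact: lt_le_trans lc.
have CG := is_Coo_potential c x.
have sG : support_in_cube 2 (kernel_potential c x).
  move=> y ny; apply: potential_out; rewrite leNgt; apply/negP => h; apply: ny.
  apply: (sqdist_cube cx); apply: le_trans (ltW h).
  by rewrite ler_peMl ?sqdist_ge0// exprn_ege1.
have HG i := is_Coo_partial i CG.
have HGG i := is_Coo_partial i (HG i).2.
have sGi i := support_in_cube_partial (HG i).1 sG.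
have sGii i := support_in_cube_partial (HGG i).1 (sGi i).
have int0 : \int[mu]_y (unit_density y * laplacian (kernel_potential c x) y) = 0.
  transitivity (\int[mu]_y laplacian (kernel_potential c x) y).
    apply: eq_Rintegral => y _.
    have [c2|c2] := pselect (cube 2 y).
      by rewrite /unit_density indicE mem_set ?mul1r//; apply: cube_le c2; rewrite ler_nat.
    by rewrite /laplacian big1 ?mulr0// => i _; exact: sGii.
  rewrite int_sum => [|i]; last first.
    by apply: L1_continuous_support (sGii i); exact: is_Coo_continuous (HGG i).2.
  apply: big1 => i _.
  rewrite /Rintegral (@int_partial0 _ _ i (partial i (kernel_potential c x)) _ 2)//.
    exact: (HGG i).1.
  exact: is_Coo_continuous (HGG i).2.
rewrite int0 mulr0 mul0r in e; move/eqP: e.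
by rewrite mulf_eq0 expf_eq0 (gt_eqF c0)/= subr_eq0 => /eqP.
Qed.

Lemma average_eq0_ae h l x : 0 < l -> L1 mu h -> {ae mu, forall y, 0 <= h y} ->
  average h l x <= 0 -> {ae mu, forall y, l ^+ 2 * sqdist x y < 1 -> h y = 0}.
Proof.
move=> l0 h1 h0 Ah; have k1 := L1_kernel x (ltW l0) h1.
have hk0 : {ae mu, forall y, `|h y * kernel l x y| = h y * kernel l x y}.
  apply: filterS h0 => y hy; rewrite ger0_norm//.
  by apply: mulr_ge0 => //; apply: kernel_ge0; exact: ltW.
have i0 : \int[mu]_y `|h y * kernel l x y| = 0.
  apply/eqP; rewrite eq_le; apply/andP; split; last exact: int_ge0.
  rewrite (int_ae _ _ hk0)//; first exact: L1_measurable (L1_norm k1).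
  exact: L1_measurable k1.
apply: filterS (int_norm_eq0 k1 i0) => y /eqP + hy.
by rewrite mulf_eq0 (gt_eqF (kernel_gt0 l0 hy)) orbF => /eqP.
Qed.

Lemma average_ae0 h l x : L1 mu h -> 0 < l ->
  {ae mu, forall y, l ^+ 2 * sqdist x y < 1 -> h y = 0} -> average h l x = 0.
Proof.
move=> h1 l0 H; transitivity (\int[mu]_y (cst 0 y : R)).
  apply: int_ae => //; first exact: L1_measurable (L1_kernel x (ltW l0) h1).
  apply: filterS H => y Hy; have [/Hy ->|hq] := ltP (l ^+ 2 * sqdist x y) 1.
    by rewrite mul0r.
  by rewrite kernel_out ?mulr0.
by rewrite Rintegral_cst// mul0r.
Qed.

(** Otherwise the density would vanish almost everywhere in the unit ball around [x], where it is 1;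
    that ball contains a box of positive measure. *)
Lemma mass_gt0 x : B1 x -> 0 < mass x.
Proof.
move=> /B1_cube cx; rewrite ltNge; apply/negP => m0.
have u0 : {ae mu, forall y, 0 <= unit_density y :> R}.
  by apply: aeW => y; rewrite /unit_density indicE.
have := average_eq0_ae ltr01 unit_density_L1 u0 m0.
(* With half-side [s = 1/(n+1)] the squared distance to the centre is at most [n s^2 < 1]. *)
have s0 : 0 < n.+1%:R^-1 :> R by rewrite invr_gt0.
set s := n.+1%:R^-1 in s0.
have s1 : s * n.+1%:R = 1 by rewrite mulVf.
pose Q := [set y : rV | forall i, `]x ord0 i - s, x ord0 i + s[%classic (y ord0 i)].
have mQ : mu Q = (\prod_(i < n) (2 * s)%:E)%E.
  rewrite (lebesgue_row_box (A := fun i => `]x ord0 i - s, x ord0 i + s[%classic)) => [|i //].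
  apply: eq_bigr => i _.
  rewrite lebesgue_measure_itv/= lte_fin ifT; last by rewrite ltrD2l gtrN.
  by rewrite -EFinB; congr EFin; ring.
move=> [N [mN N0 hN]].
have QN : Q `<=` N.
  move=> y Qy; apply: hN => /=; apply/not_implyP.
  have xy : sqdist x y < 1.
    have : sqdist x y <= \sum_(i < n) s ^+ 2.
      apply: ler_sum => i _; have := Qy i; rewrite /= in_itv/= => /andP[? ?]; nra.
    rewrite sumr_const card_ord => h; apply: le_lt_trans h _.
    have -> : (s ^+ 2 *+ n) = s * (s * n%:R) by rewrite -mulr_natr; ring.
    have sn : s * n%:R < 1 by rewrite -[ltRHS]s1 ltr_pM2l ?ltr_nat.
    have s11 : s <= 1 by rewrite -[leRHS]s1 ler_peMr ?(ltW s0)// ler1n.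
    by apply: le_lt_trans sn; rewrite ler_piMl// mulr_ge0// ltW.
  split; first by rewrite expr1n mul1r.
  rewrite /unit_density indicE mem_set; first by move/eqP; rewrite oner_eq0.
  apply: (@cube_le 2); first by rewrite ler_nat.
  by apply: sqdist_cube cx _; exact: ltW.
have : (mu Q <= 0)%E.
  rewrite -N0; apply: le_measure => //; rewrite inE//.
  rewrite (_ : Q = \bigcap_(i in [set: 'I_n])
      (row_coord i @^-1` `]x ord0 i - s, x ord0 i + s[)).
    apply: fin_bigcap_measurable => [|i _]; first exact: finite_finset.
    by rewrite -[X in measurable X]setTI; exact: measurable_row_coord.
  by apply/seteqP; split => [y h i _|y h i]; [exact: h|exact: h].
rewrite mQ leNgt => /negP; apply; elim/big_ind: _ => //.
  by move=> a b a0 b0; exact: mule_gt0.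
by move=> i _; rewrite lte_fin mulr_gt0.
Qed.

End mean_value.

(** * Small averages and the super-mean-value inequality *)

Section super_mean_value.
Context {R : realType} {n : nat}.
Local Notation rV := 'rV[R]_n.
Local Notation mu := (@lebesgue_row R n).
Implicit Types (f h u phi : rV -> R) (i : 'I_n) (x y c : rV) (l a d e : R).

Lemma continuous_mass : continuous (@mass R n).
Proof.
apply: (@continuous_average _ _ _ _ 3) => //; first exact: unit_density_L1.
exact: unit_density_support.
Qed.

Lemma mass_bounded : exists2 C : R, 0 <= C & forall x, `|mass x| <= C.
Proof.
have [C C0 hC] := average_bound (@unit_density_L1 R n); exists C => // x.
by apply: le_trans (hC 1 x ler01) _; rewrite expr1n mul1r.
Qed.

Lemma kernel_unit_density l x y : 1 <= l -> B1 y ->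
  unit_density x * kernel l y x = kernel l y x.
Proof.
move=> l1 y1; have l0 : 0 < l by exact: lt_le_trans l1.
have [h|h] := ltP (l ^+ 2 * sqdist y x) 1; last by rewrite kernel_out ?mulr0.
rewrite /unit_density indicE mem_set ?mul1r//; apply: (@cube_le _ _ 2).
  by rewrite ler_nat.
apply: sqdist_cube (B1_cube y1) _; apply: le_trans (ltW h).
by rewrite ler_peMl ?sqdist_ge0// exprn_ege1.
Qed.

(** Comparison with [C * mass y], which by [mass_scale] does not depend on [l]: the domination
    needed for the limit of small radii. *)
Lemma average_test_bounded phi : test_function phi -> exists2 C : R, 0 <= C &
  forall l y, 1 <= l -> B1 y -> `|average phi l y| <= C.
Proof.
move=> tphi; have [C C0 hC] := test_bounded tphi; have [D D0 hD] := mass_bounded.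
exists (C * D); first exact: mulr_ge0.
move=> l y l1 y1; have l0 : 0 <= l by exact: le_trans l1.
have k1 := L1_kernel y l0 (@unit_density_L1 R n).
apply: (@le_trans _ _ (C * mass y)); last first.
  by rewrite ler_wpM2l// (le_trans (ler_norm _)).
rewrite -(mass_scale y1 l1) -intZ//; apply: int_norm_le.
- exact: L1_kernel (test_L1 tphi).
- exact: L1Z.
- move=> x; rewrite kernel_unit_density// normrM (ger0_norm (kernel_ge0 _ _ l0)).
  by rewrite ler_wpM2r// kernel_ge0.
Qed.

(** The kernels concentrate at [y] with constant total mass [mass y], so the error is at most the
    oscillation of [phi] near [y] times that mass. *)
Lemma average_test_cvg phi y : test_function phi -> B1 y ->
  average phi k.+1%:R y @[k --> \oo] --> phi y * mass y.
Proof.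
move=> tphi y1; apply/cvgrPdist_le => e e0.
have m0 := mass_gt0 y1.
have em0 : 0 < e / mass y by rewrite divr_gt0.
have := test_continuous tphi (x := y).
move=> /(@cvgrPdist_le _ _ _ (nbhs y)) /(_ _ em0) /near_rowP[d d0 hd].
near=> k.
have l1 : 1 <= k.+1%:R :> R by rewrite ler1n.
have l0 : 0 <= k.+1%:R :> R by [].
(* The radius of the kernel drops below [d], so its support lies where [phi] is close to [phi y]. *)
have dl : 1 < d * k.+1%:R.
  rewrite -ltr_pdivrMl// mulr1; apply: lt_trans (truncnS_gt _) _.
  by rewrite ltr_nat ltnS; near: k; exact: nbhs_infty_gt.
set l : R := k.+1%:R in l1 l0 dl *.
have k1 := L1_kernel y l0 (@unit_density_L1 R n).
have k2 := L1_kernel y l0 (test_L1 tphi).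
rewrite -(mass_scale y1 l1) -intZ// -intB//; last exact: L1Z.
have -> : e = e / mass y * mass y by rewrite divfK// gt_eqF.
rewrite -{2}(mass_scale y1 l1) -[leRHS]intZ//; apply: int_norm_le.
- by apply: L1B => //; exact: L1Z.
- exact: L1Z.
- move=> x; rewrite !kernel_unit_density// -mulrBl normrM (ger0_norm (kernel_ge0 _ _ l0)).
  have [h|h] := ltP (l ^+ 2 * sqdist y x) 1; last by rewrite kernel_out ?mulr0.
  rewrite ler_wpM2r ?kernel_ge0//; apply: hd => i.
  have l0' : 0 < l by exact: lt_le_trans l1.
  rewrite -(ltr_pM2r l0'); apply: lt_trans dl.
  have : (l * (x ord0 i - y ord0 i)) ^+ 2 < 1.
    apply: le_lt_trans h; rewrite exprMn ler_wpM2l ?exprn_ge0//.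
    exact: coord_le_sqdist.
  move=> h2; rewrite -(gtr0_norm l0') -normrM mulrC ltr_norml.
  by apply/andP; split; nra.
Unshelve. all: by end_near. Qed.

(** Averages of an integrable [u] need not converge at a given point, so they are first moved onto
    [phi], where convergence is pointwise and dominated. *)
Lemma int_average_cvg u phi : L1 mu (on_ball u) -> test_function phi ->
  \int[mu]_x (phi x * average (on_ball u) k.+1%:R x) @[k --> \oo] -->
  \int[mu]_x (on_ball u x * (phi x * mass x)).
Proof.
move=> u1 tphi; have [C C0 hC] := average_test_bounded tphi.
have sw (k : nat) : \int[mu]_x (phi x * average (on_ball u) k.+1%:R x) =
    \int[mu]_y (on_ball u y * average phi k.+1%:R y).
  by apply: int_average_swap => //; exact: test_L1.
under eq_fun do rewrite sw.
have [] // := @dominated_cvg_int _ _ _ mu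
  (fun k y => on_ball u y * average phi k.+1%:R y)
  (fun y => on_ball u y * (phi y * mass y)) (fun y => C * `|on_ball u y|).
- move=> k; apply: measurable_funM; first exact: L1_measurable u1.
  apply: continuous_measurable_row; apply: (@continuous_average _ _ _ _ 1) => //.
    exact: test_L1.
  exact: test_support_in_cube.
- by apply: L1Z; exact: L1_norm.
- move=> y; have [y1|y1] := pselect (B1 y).
    by apply: cvgMl_tmp; exact: average_test_cvg.
  rewrite (on_ballNE _ y1) mul0r (_ : (fun k => _) = cst 0); first exact: cvg_cst.
  by apply/funext => k; rewrite mul0r.
- move=> k y; have [y1|y1] := pselect (B1 y).
    by rewrite normrM mulrC ler_wpM2r// hC// ler1n.
  by rewrite (on_ballNE _ y1) mul0r normr0 mulr0.
Qed.

(** Tested against [phi >= 0], the average at scale [l] is below the averages at larger scales, and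
    these tend weakly to [u * mass]. This replaces differentiation of integrals at almost every
    point. *)
Lemma superharmonic_mean u a l : superharmonic u -> 0 < a -> 0 < l -> a + l^-1 < 1 ->
  {ae mu, forall x, sqn x < a ^+ 2 ->
    average (on_ball u) l x <= on_ball u x * mass x}.
Proof.
move=> su a0 l0 al; have u1 := su.1.
have li0 : 0 < l^-1 by rewrite invr_gt0.
have a1 : a ^+ 2 < 1 by rewrite expr_lt1// ?ltW//; lra.
have [D D0 hD] := @mass_bounded.
have mm : measurable_fun setT (@mass R n).
  by apply: continuous_measurable_row; exact: continuous_mass.
have usupp : support_in_cube 1 (on_ball u).
  by move=> x nx; apply: on_ballNE => /B1_cube.
have cA k : 0 <= k -> continuous (average (on_ball u) k).
  by move=> k0; apply: continuous_average usupp.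
have um1 : L1 mu (fun x => on_ball u x * mass x) by exact: L1M_bounded hD.
have oA1 : L1 mu (on_ball (average (on_ball u) l)).
  by apply: L1_on_ball_continuous; apply: cA; exact: ltW.
have hL : L1 mu (fun x => on_ball u x * mass x - on_ball (average (on_ball u) l) x).
  exact: L1B.
have : {ae mu, forall x, sqn x < a ^+ 2 ->
    0 <= on_ball u x * mass x - on_ball (average (on_ball u) l) x}.
  apply: test_ge0_ae_within => // phi tphi sphi phi0.
  under eq_Rintegral do rewrite mulrBl -mulrA [mass _ * _]mulrC.
  have pA k : 0 <= k -> L1 mu (fun x => phi x * average (on_ball u) k x).
    move=> k0; apply: (@L1_continuous_support _ _ 1).
      by move=> x; apply: continuousM; [exact: test_continuous|exact: cA].
    by move=> x /(test_support_in_cube tphi) ->; rewrite mul0r.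
  rewrite intB; last first.
  - exact: L1M_test.
  - rewrite (_ : (fun x => _) = fun x => (on_ball u x * mass x) * phi x); first exact: L1M_test.
    by apply/funext => x; rewrite -mulrA [mass _ * _]mulrC.
  rewrite subr_ge0 (_ : \int[mu]_x (on_ball _ x * phi x) =
      \int[mu]_x (phi x * average (on_ball u) l x)); last first.
    apply: eq_Rintegral => x _; have [x1|x1] := pselect (B1 x).
      by rewrite on_ballE// mulrC.
    by rewrite on_ballNE// mul0r (test_out tphi) ?mul0r.
  apply/ler_addgt0Pr => e e0.
  have /cvgrPdist_le /(_ _ e0)[N _ hN] := int_average_cvg u1 tphi.
  (* Far enough for the limit to be within [e], and with scale [k + 1] at least [l]. *)
  set k := maxn N (Num.truncn l).
  have lk : l <= k.+1%:R.
    apply: le_trans (ltW (truncnS_gt l)) _.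
    by rewrite ler_nat ltnS leq_maxr.
  have := hN k (leq_maxl _ _); rewrite /= ler_norml => /andP[h _].
  have : \int[mu]_x (phi x * average (on_ball u) l x) <=
      \int[mu]_x (phi x * average (on_ball u) k.+1%:R x).
    apply: int_le; [by apply: pA; exact: ltW|exact: pA|move=> x].
    have [xa|xa] := leP (sqn x) (a ^+ 2).
      apply: ler_wpM2l; first exact: phi0.
      exact: (average_superharmonic su a0 l0 lk al xa).
    rewrite (sphi _ xa) !mul0r; exact: lexx.
  move=> /le_trans; apply.
  by move: h; rewrite lerBrDr addrC lerBlDr.
apply: filterS => x H xa.
have x1 : B1 x by apply/B1E; exact: lt_trans a1.
by have := H xa; rewrite (on_ballE (average (on_ball u) l) x1) subr_ge0.
Qed.

End super_mean_value.

(** * Positivity and the theorem *)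

Section positivity.
Context {R : realType} {n : nat}.
Local Notation rV := 'rV[R]_n.
Local Notation mu := (@lebesgue_row R n).
Implicit Types (u phi : rV -> R) (x y c : rV) (l a b d e D : R).

Definition vanishes_near u c d :=
  {ae mu, forall y, sqdist c y < d ^+ 2 -> on_ball u y = 0}.

Lemma scaled_lt1 d c y : 0 < d -> (d^-1 ^+ 2 * sqdist c y < 1) = (sqdist c y < d ^+ 2).
Proof. by move=> d0; rewrite exprVn mulrC ltr_pdivrMr ?exprn_gt0// mul1r. Qed.

(** The strong minimum principle: the average at radius [d] is 0, the one at the larger radius [D]
    is not greater, and a nonnegative function with zero average vanishes throughout the larger
    ball. *)
Lemma vanishes_enlarge u c a d D : superharmonic u ->
  {ae mu, forall y, 0 <= on_ball u y} -> 0 < a -> 0 < d -> 0 < D ->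
  sqn c <= a ^+ 2 -> a + D < 1 -> vanishes_near u c d -> vanishes_near u c D.
Proof.
move=> su u0 a0 d0 D0 ca aD vd; have [Dd|dD] := leP D d.
  apply: filterS vd => y H yD; apply: H; apply: lt_le_trans yD _.
  by rewrite lerXn2r// nnegrE ltW.
have d0' : 0 < d^-1 by rewrite invr_gt0.
have D0' : 0 < D^-1 by rewrite invr_gt0.
have A2 : average (on_ball u) d^-1 c = 0.
  apply: average_ae0 => //; first exact: su.1.
  by apply: filterS vd => y H; rewrite scaled_lt1.
have A1 : average (on_ball u) D^-1 c <= 0.
  rewrite -A2; apply: (average_superharmonic su a0 D0') => //; last by rewrite invrK.
  by rewrite lef_pV2 ?posrE// ltW.
apply: filterS (average_eq0_ae D0' su.1 u0 A1) => y H yD; apply: H.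
by rewrite scaled_lt1.
Qed.

Lemma vanishes_shift u c c' b e D : 0 < b -> 0 < e -> b + e < D ->
  sqdist c c' <= b ^+ 2 -> vanishes_near u c D -> vanishes_near u c' e.
Proof.
move=> b0 e0 beD cc'; apply: filterS => y H ye; apply: H.
apply: le_lt_trans (sqdist_triangle b0 e0 cc' (ltW ye)) _.
by rewrite ltr_pXn2r// nnegrE ltW// ?addr_gt0// (lt_trans _ beD)// addr_gt0.
Qed.

Lemma sqnZ t c : sqn (t *: c) = t ^+ 2 * sqn c.
Proof. by rewrite !sqnE mulr_sumr; apply: eq_bigr => i _; rewrite mxE exprMn. Qed.

Lemma sqdistZ t c : sqdist c (t *: c) = (1 - t) ^+ 2 * sqn c.
Proof.
by rewrite sqnE mulr_sumr; apply: eq_bigr => i _; rewrite mxE; ring.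
Qed.

(* Vanishing near a point propagates to the largest ball around it, hence in
   geometric steps to the origin, and from there to the whole unit ball. *)
Lemma vanishes_everywhere u c d : superharmonic u ->
  {ae mu, forall y, 0 <= on_ball u y} -> B1 c -> 0 < d ->
  vanishes_near u c d -> {ae mu, forall x, B1 x -> on_ball u x = 0}.
Proof.
move=> su u0 /B1E c1 d0 vd.
(* Bounds the norm of [c] and stays below 1 without a root: [q <= ((1+q)/2)^2]. *)
pose a := (1 + sqn c) / 2.
have q0 := sqdist_ge0 0 c.
have a0 : 0 < a by rewrite /a; lra.
have a1 : a < 1 by rewrite /a; lra.
have ca : sqn c <= a ^+ 2 by rewrite /a; nra.
clearbody a.
pose t := (1 + a) / 2.
have t0 : 0 < t by rewrite /t; lra.
have t1 : t < 1 by rewrite /t; lra.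
have te : 1 - t = (1 - a) / 2 by rewrite /t; field.
clearbody t.
have tk0 k : 0 < t ^+ k by rewrite exprn_gt0.
have tk1 k : t ^+ k <= 1 by rewrite exprn_ile1// ltW.
have ck k : sqn (t ^+ k *: c) <= (t ^+ k * a) ^+ 2.
  by rewrite sqnZ exprMn ler_wpM2l// ?sqr_ge0.
have tka k : t ^+ k * a <= a by rewrite ler_piMl// ltW.
have step k : exists2 e, 0 < e & vanishes_near u (t ^+ k *: c) e.
  elim: k => [|k [e e0 ve]]; first by exists d => //; rewrite expr0 scale1r.
  (* The centre has norm at most [a], so this radius fits. The next centre is within [(1-a)/2], and
     [1/2 + 1/8 < 3/4] leaves radius [(1-a)/8] around it. *)
  have vD : vanishes_near u (t ^+ k *: c) (3 / 4 * (1 - a)).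
    apply: (vanishes_enlarge su u0 _ e0 _ (ck k) _ ve); first exact: mulr_gt0.
      by lra.
    by have := tka k; lra.
  exists ((1 - a) / 8); first by lra.
  apply: (vanishes_shift (b := (1 - a) / 2) _ _ _ _ vD); [lra..|].
  rewrite exprS -scalerA sqdistZ te ler_piMr ?sqr_ge0//.
  apply: le_trans (ck k) _; rewrite exprn_ile1 ?mulr_ge0 ?(ltW a0) ?(ltW (tk0 k))//.
  by apply: le_trans (tka k) _; exact: ltW.
have [k hk] : exists k, t ^+ k < 1 / 4.
  have t_cvg : t ^+ k @[k --> \oo] --> (0 : R) by apply: cvg_expr; rewrite gtr0_norm.
  have /cvgrPdist_lt /(_ (1 / 4)) := t_cvg.
  case=> [|N _ /(_ N (leqnn N))]; first by lra.
  by rewrite /= sub0r normrN (gtr0_norm (tk0 N)) => h; exists N.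
have [e e0 ve] := step k.
have ck4 : sqn (t ^+ k *: c) <= (1 / 4) ^+ 2.
  apply: le_trans (ck k) _; rewrite lerXn2r ?nnegrE ?mulr_ge0 ?(ltW a0) ?(ltW (tk0 k))//.
  by apply: le_trans (ltW hk); rewrite ler_piMr ?(ltW (tk0 k))// ltW.
(* The centre is now within [1/4] of the origin: [1/4 + 1/2 < 1] allows this radius, and
   [1/4 + 1/8 < 1/2] then reaches the origin. *)
have v2 : vanishes_near u (t ^+ k *: c) (1 / 2).
  by apply: (vanishes_enlarge (a := 1 / 4) su u0 _ e0 _ ck4 _ ve); lra.
have v0 : vanishes_near u 0 (1 / 8).
  apply: (vanishes_shift (b := 1 / 4) _ _ _ _ v2); [lra..|].
  by rewrite sqdistC.
apply: ae_B1_exhaust => rho /andP[r0 r1].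
have vD : vanishes_near u 0 ((1 + rho) / 2).
  apply: (vanishes_enlarge (a := (1 - rho) / 4) su u0 _ _ _ _ _ v0); try lra.
  by rewrite (_ : sqn 0 = 0) ?sqr_ge0// sqnE big1// => i _; rewrite mxE expr0n.
by apply: filterS vD => x H xr; apply: H; nra.
Qed.

Lemma on_ball_ge0 u : {ae mu, forall x, B1 x -> 0 <= u x} ->
  {ae mu, forall y, 0 <= on_ball u y}.
Proof.
apply: filterS => x H; have [x1|x1] := pselect (B1 x).
  by rewrite on_ballE//; exact: H.
by rewrite on_ballNE.
Qed.

(** A zero average would start the propagation of zeros. Every [l > 0] is allowed, even if the
    kernel leaves the ball, because [on_ball u] is 0 there. *)
Lemma average_gt0 u l x : superharmonic u -> {ae mu, forall y, 0 <= on_ball u y} ->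
  ~ {ae mu, forall x, B1 x -> u x = 0} -> 0 < l -> B1 x ->
  0 < average (on_ball u) l x.
Proof.
move=> su u0 un l0 x1; rewrite ltNge; apply/negP => A0; apply: un.
have l0' : 0 < l^-1 by rewrite invr_gt0.
have v : vanishes_near u x l^-1.
  apply: filterS (average_eq0_ae l0 su.1 u0 A0) => y H; rewrite -scaled_lt1// invrK.
  exact: H.
apply: filterS (vanishes_everywhere su u0 x1 l0' v) => y H y1.
by rewrite -(on_ballE u y1); exact: H.
Qed.

Lemma compact_sqn_le (rho : R) : rho <= 1 -> compact [set x : rV | sqn x <= rho].
Proof.
move=> r1; apply: (subclosed_compact _ (@compact_cube R n 1)).
  apply: (@closed_comp _ _ (sqdist 0) [set t : R | t <= rho]) => [x _|].
    exact: continuous_sqn.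
  exact: closed_le.
by move=> x /= h; apply: sqn_cube; exact: le_trans r1.
Qed.

(** A fixed average is continuous and positive, hence bounded below on a compact ball; it is also
    below [u * mass], and [mass] is bounded above. *)
Lemma superharmonic_lower_bound u (rho : R) : superharmonic u ->
  {ae mu, forall y, 0 <= on_ball u y} -> ~ {ae mu, forall x, B1 x -> u x = 0} ->
  0 < rho < 1 -> exists2 m : R, 0 < m & {ae mu, forall x, sqn x < rho -> m <= on_ball u x}.
Proof.
move=> su u0 un /andP[r0 r1].
(* [rho <= a^2], and the radius [1/l = (1-a)/2] fits between [a] and 1. *)
pose a := (1 + rho) / 2; pose l := 2 / (1 - a).
have a0 : 0 < a by rewrite /a; lra.
have a1 : a < 1 by rewrite /a; lra.
have a10 : 0 < 1 - a by rewrite subr_gt0.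
have ra : rho <= a ^+ 2 by rewrite /a; nra.
have l0 : 0 < l by rewrite divr_gt0.
have al : a + l^-1 < 1 by rewrite /l invf_div; lra.
have K0 : [set x : rV | sqn x <= rho] !=set0.
  exists 0; rewrite /= sqnE big1 ?(ltW r0)// => i _; by rewrite mxE expr0n.
have cA : continuous (average (on_ball u) l).
  apply: (@continuous_average _ _ _ _ 1) => //; [exact: ltW|exact: su.1|].
  by move=> x nx; apply: on_ballNE => /B1_cube.
have [c cK cmin] := EVT_min_rV K0 (compact_sqn_le (ltW r1)) (continuous_subspaceT cA).
have c1 : B1 c by apply/B1E; rewrite inE in cK; exact: le_lt_trans r1.
have m0 := average_gt0 su u0 un l0 c1.
have [C C0 hC] := @mass_bounded R n.
have C1 : 0 < C + 1 by rewrite ltr_wpDl.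
exists (average (on_ball u) l c / (C + 1)); first by rewrite divr_gt0.
apply: filterS2 (superharmonic_mean su a0 l0 al) u0 => x H ux xr.
rewrite ler_pdivrMr//; apply: le_trans (cmin x _) _; first by rewrite inE; exact: ltW.
apply: le_trans (H _) _; first exact: lt_le_trans ra.
rewrite ler_wpM2l//; apply: le_trans (ler_norm _) _; apply: le_trans (hC x) _.
by rewrite lerDl.
Qed.

End positivity.

(** * Harmonicity of the minimiser and its continuous representative *)

Section minimisers.
Context {R : realType} {n : nat}.
Local Notation rV := 'rV[R]_n.
Local Notation mu := (@lebesgue_row R n).
Variable u : rV -> R.
Hypothesis umin : minimiser u.
Hypothesis u_ge0 : {ae mu, forall x, B1 x -> 0 <= u x}.
Hypothesis u_neq0 : ~ {ae mu, forall x, B1 x -> u x = 0}.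
Implicit Types (phi : rV -> R) (x : rV).

Let Hu : H1 u := umin.1.

Lemma minimiser_is_superharmonic : superharmonic u.
Proof.
split; first exact: L2_L1 Hu.1.
move=> phi tphi phi0; rewrite int_laplacian// oppr_le0.
exact: minimiser_superharmonic.
Qed.

Let u0 := on_ball_ge0 u_ge0.

Lemma minimiser_gt0 : {ae mu, forall x, B1 x -> 0 < u x}.
Proof.
apply: ae_B1_exhaust => rho r01.
have [m m0] := superharmonic_lower_bound minimiser_is_superharmonic u0 u_neq0 r01.
apply: filterS => x H xr; have x1 : B1 x.
  by apply/B1E; apply: lt_trans xr _; case/andP: r01.
by rewrite -(on_ballE u x1); apply: lt_le_trans m0 _; exact: H.
Qed.

(** [phi] may change sign now: on its support [u] has a positive lower bound, and elsewhere [u] is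
    already positive, so the competitor needs no multiple of [bump 1]. *)
Lemma minimiser_form_ge0 phi : test_function phi -> 0 <= dirichlet_form u phi.
Proof.
move=> tphi; have [C C0 hC] := test_bounded tphi.
have [rho /andP[r0 r1] sphi] := test_supp_within tphi.
have r01 : 0 < (1 + rho) / 2 < 1 by apply/andP; split; lra.
have [m m0 hm] := superharmonic_lower_bound minimiser_is_superharmonic u0 u_neq0 r01.
have C1 : 0 < C + 1 by rewrite ltr_wpDl.
(* Then [|t s phi| <= s C < m] for [t <= 1], which keeps [u + t s phi] positive. *)
have [s s0 sC] : exists2 s, 0 < s & s * (C + 1) = m.
  by exists (m / (C + 1)); rewrite ?divr_gt0// divfK// gt_eqF.
have tz := testZ s tphi; set z := fun x => _ in tz.
rewrite -(pmulr_rge0 _ s0) -dirichlet_formZ//; last exact: tphi.1.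
rewrite -/z -(@pmulr_rge0 _ 2)//.
apply: (@linear_coef_ge0 _ _ (dirichlet_smooth z)) => t t0 t1.
have := @minimiser_dirichlet_le _ _ u (fun x => t * z x) 0 umin (testZ t tz).
rewrite (_ : (fun x => t * z x + 0 * bump 1 x) = fun x => t * z x); last first.
  by apply/funext => x; rewrite mul0r addr0.
rewrite (dirichlet_formZ t Hu tz.1) (dirichlet_smoothZ t tz.1) mulrCA; apply.
apply: filterS2 hm minimiser_gt0 => x hx ux x1; rewrite mul0r addr0.
have [xr|xr] := ltP (sqn x) ((1 + rho) / 2).
  have := hx xr; rewrite on_ballE// => um.
  have zC : `|t * z x| <= s * C.
    rewrite normrM (gtr0_norm t0) /z normrM (gtr0_norm s0).
    by rewrite -[leRHS]mul1r ler_pM ?mulr_ge0 ?(ltW t0) ?(ltW s0)// ler_wpM2l// ltW.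
  have := ler_norm (- (t * z x)); rewrite normrN => h.
  have : s * C < m by rewrite -sC ltr_pM2l// ltrDl.
  by lra.
rewrite /z sphi ?mulr0 ?addr0; first exact: ux.
by apply: lt_le_trans xr; lra.
Qed.

Lemma minimiser_form_eq0 phi : test_function phi -> dirichlet_form u phi = 0.
Proof.
move=> tphi; apply/eqP; rewrite eq_le minimiser_form_ge0// andbT.
have := minimiser_form_ge0 (testZ (-1) tphi).
by rewrite dirichlet_formZ//; [rewrite mulN1r oppr_ge0|exact: tphi.1].
Qed.

(** Harmonicity in the form in which the one-sided averaging lemmas apply to [u] and to its
    opposite, and so become equalities. *)
Lemma minimiser_opp_superharmonic : superharmonic (fun x => -1 * u x).
Proof.
have e x : on_ball (fun x => -1 * u x) x = -1 * on_ball u x by exact: on_ballZ.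
split; first by rewrite (funext e); apply: L1Z; exact: L2_L1 Hu.1.
move=> phi tphi _; under eq_Rintegral do rewrite e -mulrA.
rewrite intZ; last first.
  rewrite (_ : (fun x => _) = fun x => \sum_i (on_ball u x * partial i (partial i phi) x)).
    apply: L1_sum => i; apply: L1M_test; first exact: L2_L1 Hu.1.
    by do 2 apply: test_partial.
  by apply/funext => x; rewrite mulr_sumr.
by rewrite int_laplacian// minimiser_form_eq0// oppr0 mulr0.
Qed.

Lemma average_opp l x : 0 < l ->
  average (on_ball (fun x => -1 * u x)) l x = - average (on_ball u) l x.
Proof.
move=> l0; rewrite -[RHS]mulN1r /average -intZ; last first.
  by apply: L1_kernel; [exact: ltW|exact: L2_L1 Hu.1].
by apply: eq_Rintegral => y _; rewrite on_ballZ mulrA.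
Qed.

Lemma minimiser_average_const (a l1 l2 : R) x : 0 < a -> 0 < l1 -> l1 <= l2 ->
  a + l1^-1 < 1 -> sqn x <= a ^+ 2 ->
  average (on_ball u) l1 x = average (on_ball u) l2 x.
Proof.
move=> a0 l10 l12 al xa; apply/eqP; rewrite eq_le.
rewrite (average_superharmonic minimiser_is_superharmonic a0 l10 l12 al xa)/=.
have := average_superharmonic minimiser_opp_superharmonic a0 l10 l12 al xa.
by rewrite !average_opp ?lerN2//; exact: lt_le_trans l12.
Qed.

Lemma minimiser_mean (a l : R) : 0 < a -> 0 < l -> a + l^-1 < 1 ->
  {ae mu, forall x, sqn x < a ^+ 2 -> average (on_ball u) l x = on_ball u x * mass x}.
Proof.
move=> a0 l0 al.
apply: filterS2 (superharmonic_mean minimiser_is_superharmonic a0 l0 al)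
  (superharmonic_mean minimiser_opp_superharmonic a0 l0 al) => x h1 h2 xa.
apply/eqP; rewrite eq_le h1//=; have := h2 xa.
by rewrite average_opp// on_ballZ mulN1r mulNr lerN2.
Qed.

(** The radius [(1 - sqn x) / 4] fits in the ball at each [x]: added to the norm bound
    [(1 + sqn x) / 2] it stays below 1. *)
Definition mean_scale x : R := 4 / (1 - sqn x).

(** The scale depends on [x] so that one formula serves the whole ball; by [mean_representativeE]
    any fitting scale gives the same value. *)
Definition mean_representative x : R := average (on_ball u) (mean_scale x) x / mass x.

Lemma mean_representativeE (a l : R) x : 0 < a -> 0 < l -> a + l^-1 < 1 ->
  sqn x <= a ^+ 2 -> mean_representative x = average (on_ball u) l x / mass x.
Proof.
move=> a0 l0 al xa; apply: (congr1 (fun z => z / mass x)).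
have x1 : sqn x < 1.
  apply: le_lt_trans xa _; rewrite expr_lt1 ?(ltW a0)//.
  have : 0 < l^-1 by rewrite invr_gt0.
  by lra.
have q0 := sqdist_ge0 0 x.
have x10 : 0 < 1 - sqn x by rewrite subr_gt0.
have s0 : 0 < mean_scale x by rewrite divr_gt0.
have b0 : 0 < (1 + sqn x) / 2 by lra.
have xb : sqn x <= ((1 + sqn x) / 2) ^+ 2 by nra.
have bs : (1 + sqn x) / 2 + (mean_scale x)^-1 < 1 by rewrite /mean_scale invf_div; lra.
have [h|/ltW h] := leP (mean_scale x) l.
  exact: minimiser_average_const b0 s0 h bs xb.
by apply/esym; exact: minimiser_average_const a0 l0 h al xa.
Qed.

Lemma mean_representative_ae : {ae mu, forall x, B1 x -> u x = mean_representative x}.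
Proof.
apply: ae_B1_exhaust => rho /andP[r0 r1].
pose a := (1 + rho) / 2; pose l := 2 / (1 - a).
have a0 : 0 < a by rewrite /a; lra.
have a1 : a < 1 by rewrite /a; lra.
have l0 : 0 < l by rewrite divr_gt0// subr_gt0.
have al : a + l^-1 < 1 by rewrite /l invf_div; lra.
have ra : rho <= a ^+ 2 by rewrite /a; nra.
apply: filterS (minimiser_mean a0 l0 al) => x H xr.
have xa : sqn x < a ^+ 2 by exact: lt_le_trans ra.
have x1 : B1 x by apply/B1E; exact: lt_trans r1.
rewrite (mean_representativeE a0 l0 al (ltW xa)) H// mulfK ?on_ballE//.
by rewrite gt_eqF// mass_gt0.
Qed.

Lemma mean_representative_gt0 x : B1 x -> 0 < mean_representative x.
Proof.
move=> x1; rewrite divr_gt0 ?mass_gt0//.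
apply: (average_gt0 minimiser_is_superharmonic u0 u_neq0) => //.
by rewrite divr_gt0// subr_gt0; exact/B1E.
Qed.

(** Near [x] a single scale fits at all points, so locally this is a quotient of two continuous
    averages. *)
Lemma mean_representative_continuous x : B1 x -> {for x, continuous mean_representative}.
Proof.
move=> x1; have := (B1E x).1 x1 => q1; have q0 := sqdist_ge0 0 x.
pose rho := (1 + sqn x) / 2; pose a := (1 + rho) / 2; pose l := 2 / (1 - a).
have r1 : rho < 1 by rewrite /rho; lra.
have r0 : 0 < rho by rewrite /rho; lra.
have xr : sqn x < rho by rewrite /rho; lra.
have a0 : 0 < a by rewrite /a; lra.
have a1 : a < 1 by rewrite /a; lra.
have l0 : 0 < l by rewrite divr_gt0// subr_gt0.
have al : a + l^-1 < 1 by rewrite /l invf_div; lra.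
have ra : rho <= a ^+ 2 by rewrite /a; nra.
pose g y := average (on_ball u) l y / mass y.
have cA : continuous (average (on_ball u) l).
  apply: (@continuous_average _ _ _ _ 1) => //; [exact: ltW|exact: L2_L1 Hu.1|].
  by move=> y ny; apply: on_ballNE => /B1_cube.
have cg : {for x, continuous g}.
  apply: continuousM; first exact: cA.
  apply: continuousV; last exact: continuous_mass.
  by rewrite gt_eqF// mass_gt0.
have near_g : \forall y \near x, g y = mean_representative y.
  have hA : nbhs (sqn x) [set t : R | t < rho].
    by apply: open_nbhs_nbhs; split => //; exact: open_lt.
  have hn : nbhs x (sqdist 0 @^-1` [set t : R | t < rho]).
    exact: (@continuous_sqn R n x _ hA).
  apply: filterS hn => y /= yr; apply/esym; apply: (mean_representativeE a0 l0 al).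
  by apply: le_trans ra; exact: ltW.
rewrite /prop_for /continuous_at -(nbhs_singleton near_g).
exact: cvg_trans (near_eq_cvg near_g) cg.
Qed.

End minimisers.

Theorem proposition2p1 (R : realType) (n : nat) (n_gt0 : (0 < n)%N)
    (u : 'rV[R]_n -> R)
    (u_min : minimiser u)
    (u_ge0 : {ae lebesgue_row n, forall x, B1 x -> 0 <= u x})
    (u_neq0 : ~ {ae lebesgue_row n, forall x, B1 x -> u x = 0}) :
  exists w : 'rV[R]_n -> R,
    [/\ {ae lebesgue_row n, forall x, B1 x -> u x = w x},
        (forall x, B1 x -> {for x, continuous w}) &
        (forall x, B1 x -> 0 < w x)].
Proof.
exists (mean_representative u); split.
- exact: mean_representative_ae.
- exact: mean_representative_continuous.
- exact: mean_representative_gt0.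
Qed.
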